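(* Let $A$ and $B$ be any complex matrices of the same size. For $1<p\le 2$, $$\|A+B\|_p^2+\|A-B\|_p^2\ \ge\ 2\|A\|_p^2+2(p-1)\|B\|_p^2 .$$ For $2\le p<\infty$ the inequality is reversed, that is, $$\|A+B\|_p^2+\|A-B\|_p^2\ \le\ 2\|A\|_p^2+2(p-1)\|B\|_p^2 .$$
   Context: For a complex matrix $X$ and $1<p<\infty$, $\|X\|_p:=\left(\mathrm{Tr}\,|X|^p\right)^{1/p}$ denotes the Schatten $p$-norm, where $|X|=(X^*X)^{1/2}$ and $\mathrm{Tr}$ is the usual (unnormalized) matrix trace. *)

(* Defs.v *)
From HB Require Import structures.
From mathcomp Require Import all_boot all_order all_algebra.
From mathcomp Require Import complex.
From mathcomp Require Import boolp classical_sets reals exp.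

Set Implicit Arguments.
Unset Strict Implicit.
Unset Printing Implicit Defensive.
Import Order.TTheory GRing.Theory Num.Theory.
Local Open Scope ring_scope.
Local Open Scope complex_scope.
Local Open Scope sesquilinear_scope.

(* Functional calculus f(H) for a Hermitian matrix H: if H = P^-1 D P with P
   unitary and D real diagonal, then f(H) = P^-1 f(D) P.  The eigenvalues are
   complex numbers with zero imaginary part, hence the projection by Re.  Only
   meaningful when H is Hermitian; by herm_calcE the value does not then depend
   on the diagonalization returned by spectralmx. *)
Definition herm_calc (R : realType) (n : nat) (f : R -> R) (H : 'M[R[i]]_n) :
    'M[R[i]]_n :=
  invmx (spectralmx H)
    *m diag_mx (map_mx (fun z => (f (complex.Re z))%:C) (spectral_diag H))
    *m spectralmx H.

Lemma map_diag_similar (K : numClosedFieldType) (n : nat) (f : K -> K) (P U : 'M[K]_n)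
    (d e : 'rV[K]_n) :
  P \in unitmx -> U \in unitmx ->
  invmx P *m diag_mx e *m P = invmx U *m diag_mx d *m U ->
  invmx P *m diag_mx (map_mx f e) *m P = invmx U *m diag_mx (map_mx f d) *m U.
Proof.
move=> Pu Uu; have conjE a b : invmx P *m a *m P = invmx U *m b *m U <->
    a *m (P *m invmx U) = (P *m invmx U) *m b.
  split=> E.
    have aP : a *m P = P *m (invmx U *m b *m U).
      by rewrite -E -(mulmxA (invmx P)) mulKVmx.
    by rewrite mulmxA aP -!mulmxA mulmxV// mulmx1.
  have aP : a *m P = P *m (invmx U *m b *m U).
    by rewrite -[LHS](mulmxKV Uu) -(mulmxA a) E !mulmxA.
  by rewrite -(mulmxA (invmx P)) aP mulKmx.
move=> /conjE; move=> WE; apply/conjE; move: WE.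
move: (P *m invmx U) => V VE.
apply/matrixP => i j; move/matrixP/(_ i j): VE.
rewrite !mul_diag_mx !mul_mx_diag !mxE mulrC => /eqP.
have [->|V0] := eqVneq (V i j) 0; first by rewrite mulr0 !mul0r.
by move=> /eqP /(mulfI V0) ->; rewrite mulrC.
Qed.

Lemma spectral_map_sqr (C : numClosedFieldType) (n : nat) (g : C -> C)
    (H : 'M[C]_n) :
  H \is normalmx ->
  (forall i, g (spectral_diag H 0 i) ^+ 2 = spectral_diag H 0 i) ->
  let S := invmx (spectralmx H) *m diag_mx (map_mx g (spectral_diag H))
             *m spectralmx H in
  S *m S = H.
Proof.
move=> /orthomx_spectralP HE gK; rewrite /= [RHS]HE.
move: (spectralmx H) (spectral_unit H) (spectral_diag H) gK => P Pu d gK.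
rewrite !mulmxA mulmxK// -(mulmxA _ (diag_mx _) (diag_mx _)) mulmx_diag.
by congr (_ *m diag_mx _ *m _); apply/rowP => i; rewrite !mxE -expr2.
Qed.

Lemma herm_calcE (R : realType) (n : nat) (f : R -> R) (U H : 'M[R[i]]_n)
    (d : 'rV[R[i]]_n) :
  U \in unitmx -> H \is normalmx -> H = invmx U *m diag_mx d *m U ->
  herm_calc f H =
    invmx U *m diag_mx (map_mx (fun z => (f (complex.Re z))%:C) d) *m U.
Proof.
move=> Uu /orthomx_spectralP HE HU.
by apply: map_diag_similar; rewrite ?spectral_unit// -HE -HU.
Qed.

Definition absmx (R : realType) (m n : nat) (X : 'M[R[i]]_(m, n)) :
    'M[R[i]]_n :=
  herm_calc Num.sqrt (X ^t* *m X).

(* The trace is a nonnegative real, so that Re only changes its type. *)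
Definition schatten (R : realType) (m n : nat) (p : R)
    (X : 'M[R[i]]_(m, n)) : R :=
  (complex.Re (\tr (herm_calc (fun t => t `^ p) (absmx X)))) `^ p^-1.

Lemma adjmxM (C : numClosedFieldType) (a b c : nat) (Y : 'M[C]_(a, b))
    (Z : 'M[C]_(b, c)) : (Y *m Z) ^t* = Z ^t* *m Y ^t*.
Proof. by rewrite trmx_mul map_mxM. Qed.

Lemma adjmxK (C : numClosedFieldType) (a b : nat) (Y : 'M[C]_(a, b)) :
  (Y ^t*) ^t* = Y.
Proof. by apply/matrixP => i j; rewrite !mxE conjCK. Qed.

(* absmx X is the positive semidefinite square root of X^* X. *)
Section Absmx.
Variables (R : realType) (m n : nat) (X : 'M[R[i]]_(m, n)).

Lemma gram_hermitian : (X ^t* *m X) ^t* = X ^t* *m X.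
Proof. by rewrite adjmxM adjmxK. Qed.

Lemma gram_diag_ge0 i : 0 <= spectral_diag (X ^t* *m X) 0 i.
Proof.
set H := X ^t* *m X; set P := spectralmx H.
have Hn : H \is normalmx by apply/normalmxP; rewrite gram_hermitian.
have /orthomx_spectralP HE := Hn.
have DE : diag_mx (spectral_diag H) = (X *m P ^t*) ^t* *m (X *m P ^t*).
  rewrite adjmxM adjmxK -invmx_unitary ?spectral_unitarymx//.
  rewrite !mulmxA -(mulmxA _ _ X) -/H {2}HE !mulmxA.
  by rewrite mulmxV ?spectral_unit// mul1mx mulmxK ?spectral_unit.
have -> : spectral_diag H 0 i = diag_mx (spectral_diag H) i i.
  by rewrite mxE eqxx.
rewrite DE mxE sumr_ge0// => k _.
by rewrite !mxE mulrC mul_conjC_ge0.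
Qed.

Lemma absmx_sqr : absmx X *m absmx X = X ^t* *m X.
Proof.
apply: spectral_map_sqr => [|i].
  by apply/normalmxP; rewrite gram_hermitian.
have := gram_diag_ge0 i; case: (spectral_diag _ 0 i) => a b.
rewrite lecE /= => /andP[/eqP -> a0].
by rewrite -rmorphXn /= sqr_sqrtr.
Qed.

Lemma absmx_hermitian : (absmx X) ^t* = absmx X.
Proof.
rewrite /absmx /herm_calc invmx_unitary ?spectral_unitarymx// !adjmxM adjmxK.
rewrite mulmxA; congr (_ *m _ *m _).
apply/matrixP => i j; rewrite !mxE eq_sym; case: eqP => [->|_].
  by rewrite !mulr1n; apply/eqP; rewrite eq_complex /= oppr0 !eqxx.
by rewrite !mulr0n conjC0.
Qed.

Lemma absmx_ge0 (v : 'cV[R[i]]_n) : 0 <= (v ^t* *m absmx X *m v) 0 0.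
Proof.
rewrite /absmx /herm_calc invmx_unitary ?spectral_unitarymx//.
set P := spectralmx _; set D := diag_mx _.
have -> : v ^t* *m (P ^t* *m D *m P) *m v = (P *m v) ^t* *m (D *m (P *m v)).
  by rewrite adjmxM !mulmxA.
rewrite mxE sumr_ge0// => k _; rewrite mul_diag_mx !mxE.
rewrite mulrCA mulr_ge0//; first by rewrite lecR sqrtr_ge0.
by rewrite mulrC mul_conjC_ge0.
Qed.

End Absmx.

(* Main.v *)
(* Let h(x) = sgn(x) |x|^(p-1), 1 < p <= 2, and let P, Q be Hermitian with
   eigenvalues x_i, y_j and eigenbases e_i, f_j.  With D = P - Q, expanding in the
   two bases at once gives

     Tr (h(P) - h(Q)) D = sum_ij |<e_i, D f_j>|^2 (h(x_i) - h(y_j)) / (x_i - y_j)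
       >= (p-1) sum_ij |<e_i, D f_j>|^2 ((|x_i| + |y_j|) / 2)^(p-2).

   The power p - 2 is a superposition of resolvents m |-> 1 / (m + s), and for
   each resolvent the last sum decreases when |P| and |Q| are replaced by their
   diagonal parts in an eigenbasis of D.  Hoelder's and Jensen's inequalities for
   sequences then give the lower bound

     (p-1) ||D||_p^2 ((||P||_p^p + ||Q||_p^p) / 2)^((p-2)/p).

   Applied to P = A + tB and Q = A - tB, whose sum of p-th powers of norms is even
   in t and has p Tr (h(P) - h(Q)) B as a subgradient, this bounds below the growth
   of t |-> ((||A+tB||_p^p + ||A-tB||_p^p) / 2)^(2/p) on [0, 1]; no derivative of a
   matrix function is needed.  The case p >= 2 follows by duality, and rectangular
   matrices are reduced to Hermitian ones by X |-> [[0, X], [X^*, 0]]. *)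
From HB Require Import structures.
Require Import Defs.
From mathcomp Require Import all_boot all_order all_algebra.
From mathcomp Require Import complex.
From mathcomp Require Import reals exp.
From mathcomp Require Import ring lra.
From mathcomp Require Import boolp classical_sets functions.
From mathcomp Require Import topology normedtype sequences derive realfun.
Set Implicit Arguments.
Unset Strict Implicit.
Unset Printing Implicit Defensive.
Import Order.TTheory GRing.Theory Num.Theory.
Import numFieldNormedType.Exports.
Local Open Scope ring_scope.
Local Open Scope complex_scope.
Local Open Scope sesquilinear_scope.

(** * Scalar inequalities for real powers *)

Section PowerInequalities.
Variable R : realType.
Implicit Types x y p a : R.

(** The odd power function; for p > 1, p times its value at exponent p - 1 is the derivative of
    |x|^p. *)
Definition spowR p x : R := Num.sg x * `|x| `^ p.

Lemma spowR_mulr p x : 0 < p -> spowR (p - 1) x * x = `|x| `^ p.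
Proof.
move=> p0; rewrite /spowR mulrAC -normrEsg mulr_powRB1//.
Qed.

Lemma normr_spowR p x : p != 0 -> `|spowR p x| = `|x| `^ p.
Proof.
move=> p0; rewrite /spowR normrM (ger0_norm (powR_ge0 _ _)).
have [->|x0] := eqVneq x 0; first by rewrite normr0 powR0// mulr0.
by rewrite normr_sg x0 mul1r.
Qed.

(** Young's inequality for y and x^(p-1) with exponents p and p/(p-1), cleared of denominators. The
    tangent inequalities below come from it without differentiation. *)
Lemma powR_young p x y : 1 < p -> 0 <= x -> 0 <= y ->
  p * (x `^ (p - 1) * y) <= y `^ p + (p - 1) * x `^ p.
Proof.
move=> p1 x0 y0; have p0 : 0 < p by lra.
have pm0 : 0 < p - 1 by lra.
have q0 : 0 < p / (p - 1) by rewrite divr_gt0.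
have := @conjugate_powR R y (x `^ (p - 1)) p (p / (p - 1)) y0 (powR_ge0 _ _) p0 q0.
rewrite -powRrM (mulrCA (p - 1)) divff ?gt_eqF// mulr1 => H.
have {}H : y * x `^ (p - 1) <= y `^ p / p + x `^ p / (p / (p - 1)).
  by apply: H; field; rewrite !gt_eqF.
rewrite -(ler_pM2l p0) in H.
rewrite [x `^ _ * y]mulrC (le_trans H)// le_eqVlt; apply/orP; left.
by apply/eqP; field; rewrite !gt_eqF.
Qed.

Lemma normr_powR_tangent p x y : 1 < p ->
  `|x| `^ p + p * spowR (p - 1) x * (y - x) <= `|y| `^ p.
Proof.
move=> p1; have p0 : 0 < p by lra.
have pm0 : p - 1 != 0 by lra.
have := powR_young p1 (normr_ge0 x) (normr_ge0 y).
have := spowR_mulr x p0.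
have : spowR (p - 1) x * y <= `|x| `^ (p - 1) * `|y|.
  by rewrite (le_trans (ler_norm _))// normrM normr_spowR.
rewrite -(ler_pM2l p0); nra.
Qed.

Lemma powR_tangent a x y : 1 <= a -> 0 <= x -> 0 <= y ->
  x `^ a + a * x `^ (a - 1) * (y - x) <= y `^ a.
Proof.
rewrite le_eqVlt => /predU1P[<- x0 y0|a1 x0 y0].
  by rewrite subrr powRr0 !powRr1// mulr1 mul1r; lra.
have a0 : 0 < a by lra.
have := powR_young a1 x0 y0.
by rewrite mulrBr -!mulrA [_ * x]mulrC mulr_powRB1//; lra.
Qed.

Lemma powR_div x y p : 0 <= x -> 0 <= y -> (x / y) `^ p = x `^ p / y `^ p.
Proof.
move=> x0 y0; rewrite powRM ?invr_ge0//; congr (_ * _).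
by rewrite -powR_inv1// -powRrM mulrC powRrM powR_inv1 ?powR_ge0.
Qed.

(** Average the tangent inequality at the mean [m]: the linear terms cancel. *)
Lemma powR_jensen (I : finType) (w x : I -> R) a : 1 <= a ->
  (forall i, 0 <= w i) -> \sum_i w i = 1 -> (forall i, 0 <= x i) ->
  (\sum_i w i * x i) `^ a <= \sum_i w i * x i `^ a.
Proof.
move=> a1 w0 w1 x0; set m := \sum_i w i * x i.
have m0 : 0 <= m by apply: sumr_ge0 => i _; rewrite mulr_ge0.
have : \sum_i w i * (m `^ a + a * m `^ (a - 1) * (x i - m)) <=
       \sum_i w i * x i `^ a.
  by apply: ler_sum => i _; rewrite ler_wpM2l// powR_tangent.
apply: le_trans; rewrite le_eqVlt; apply/orP; left; apply/eqP.
transitivity (\sum_i (w i * (m `^ a - a * m `^ (a - 1) * m)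
               + a * m `^ (a - 1) * (w i * x i))).
  by rewrite big_split/= -mulr_suml w1 -mulr_sumr -/m; ring.
by apply: eq_bigr => i _; ring.
Qed.

Lemma powR_midpoint a x y : 1 <= a -> 0 <= x -> 0 <= y ->
  ((x + y) / 2) `^ a <= (x `^ a + y `^ a) / 2.
Proof.
move=> a1 x0 y0.
have m0 : 0 <= (x + y) / 2 by rewrite divr_ge0// addr_ge0.
have := powR_tangent a1 m0 x0; have := powR_tangent a1 m0 y0.
by set c := a * _; lra.
Qed.

Lemma ler_powRN a x y : 0 <= a -> 0 < x -> x <= y -> y `^ (- a) <= x `^ (- a).
Proof.
move=> a0 x0 xy; rewrite !powRN lef_pV2 ?posrE ?powR_gt0//; last first.
  exact: lt_le_trans xy.
by rewrite ge0_ler_powR// nnegrE ltW//; exact: lt_le_trans xy.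
Qed.

(** Since (x+d)(x-d) <= x^2, the outer powers have product at least the square of the middle one;
    the arithmetic-geometric mean inequality concludes. *)
Lemma powRN_midpoint_convex a x d : 0 <= a -> 0 <= d -> d < x ->
  2 * x `^ (- a) <= (x + d) `^ (- a) + (x - d) `^ (- a).
Proof.
move=> a0 d0 dx.
set u := (x + d) `^ _; set v := (x - d) `^ _; set w := x `^ _.
have x0 : 0 < x by lra.
have u0 : 0 <= u by exact: powR_ge0.
have v0 : 0 <= v by exact: powR_ge0.
have w0 : 0 <= w by exact: powR_ge0.
have : w * w <= u * v.
  rewrite -!powRM; [|lra..].
  by apply: ler_powRN => //; nra.
move=> wuv; rewrite -(ler_pXn2r (ltn0Sn 1)) ?nnegrE ?mulr_ge0 ?addr_ge0//.
by have := sqr_ge0 (u - v); rewrite !expr2; nra.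
Qed.

(** The tangent at 1 of the convex power 1/t, evaluated at x^t. *)
Lemma powR_concave_tangent1 t x : 0 < t <= 1 -> 0 <= x ->
  x `^ t <= 1 + t * (x - 1).
Proof.
move=> /andP[t0 t1] x0.
have ti : 1 <= t^-1 by rewrite invf_ge1.
have := powR_tangent ti ler01 (powR_ge0 x t).
rewrite !powR1 -powRrM mulfV ?gt_eqF// powRr1//.
rewrite -(ler_pM2l t0) mulrDr !mulr1 mulrA divff ?gt_eqF// mul1r; lra.
Qed.

(** Dividing by x^c leaves c 2^(1-c) <= 1, which follows from 2^(1-c) <= 2 - c and c (2 - c) <=
    1. *)
Lemma powR_secant_at0 c x : 0 < c <= 1 -> 0 <= x ->
  c * x * (x / 2) `^ (c - 1) <= x `^ c.
Proof.
move=> /andP[c0 c1]; rewrite le_eqVlt => /predU1P[<-|x0].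
  by rewrite mulr0 mul0r powR_ge0.
have -> : x `^ c = x * x `^ (c - 1) by rewrite mulr_powRB1// ltW.
rewrite powRM; [|lra..].
have -> : (2^-1 : R) `^ (c - 1) = 2 `^ (1 - c).
  by rewrite -[2^-1](@powR_inv1 R) ?ler0n// -powRrM; congr powR; ring.
have w0 : 0 <= x `^ (c - 1) by exact: powR_ge0.
have H : 2 `^ (1 - c) <= 2 - c.
  have [->|c1'] := eqVneq c 1; first by rewrite subrr powRr0; lra.
  have t0 : 0 < 1 - c <= 1 by rewrite subr_gt0 lt_neqAle c1' c1/=; lra.
  by have := powR_concave_tangent1 t0 (ler0n R 2); lra.
have : c * 2 `^ (1 - c) <= 1 by nra.
move: (2 `^ _) => z zc; have : 0 <= x * x `^ (c - 1) by rewrite mulr_ge0// ltW.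
by move: (x `^ _) w0 => w w0; nra.
Qed.

(* Hermite-Hadamard for the convex function t |-> t `^ (c - 1). *)
Lemma powR_secant c x y : 0 < c <= 1 -> 0 <= y <= x ->
  c * (x - y) * ((x + y) / 2) `^ (c - 1) <= x `^ c - y `^ c.
Proof.
move=> c01 /andP[]; rewrite le_eqVlt => /predU1P[<- x0|y0 yx].
  have /andP[c0 _] := c01.
  by rewrite powR0 ?gt_eqF// subr0 !(addr0, subr0); exact: powR_secant_at0.
have /andP[c0 c1] := c01.
set a := (x + y) / 2; set e := (x - y) / 2.
(* [g] is the gap as a function of the half-distance, with the midpoint [a] fixed. It vanishes at 0
   and its derivative is nonnegative by midpoint convexity; y > 0 keeps a - d positive up to d =
   e. *)
pose g d := (a + d) `^ c - (a - d) `^ c - 2 * c * d * a `^ (c - 1).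
pose dg d := c * (a + d) `^ (c - 1) + c * (a - d) `^ (c - 1) - 2 * c * a `^ (c - 1).
have e0 : 0 <= e by rewrite /e; lra.
have ea : e < a by rewrite /e /a; lra.
have dgE d : 0 <= d <= e -> is_derive d 1 g (dg d).
  move=> /andP[d0 de].
  have p1 : 0 < a + d by lra.
  have p2 : 0 < a - d by lra.
  have D1 : is_derive d 1 (fun d => a + d) 1.
    by have := is_deriveD (is_derive_cst a d 1) (is_derive_id d 1); rewrite add0r.
  have D2 : is_derive d 1 (fun d => a - d) (-1).
    by have := is_deriveB (is_derive_cst a d 1) (is_derive_id d 1); rewrite sub0r.
  have E1 := @is_derive1_comp _ _ _ d _ _ (is_derive1_powR c p1) D1.
  have E2 := @is_derive1_comp _ _ _ d _ _ (is_derive1_powR c p2) D2.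
  have E3 : is_derive d 1 (fun d => 2 * c * d * a `^ (c - 1)) (2 * c * a `^ (c - 1)).
    have := is_deriveZ (2 * c * a `^ (c - 1)) (is_derive_id d 1).
    rewrite -[_ *: 1]/(_ * 1) mulr1; congr is_derive.
    by apply/funext => z; rewrite -[LHS]/(_ * z); ring.
  have := is_deriveB (is_deriveB E1 E2) E3.
  by rewrite mulr1 mulrN1 opprK.
have cg : {within `[0, e], continuous g}%classic.
  apply: derivable_within_continuous => d; rewrite in_itv/= => de.
  by have [] := dgE _ de.
have dgI d : d \in `]0, e[ -> is_derive d 1 g (dg d).
  by rewrite in_itv/= => /andP[/ltW d0 /ltW de]; apply: dgE; rewrite d0.
have [d] := MVT_segment e0 dgI cg.
rewrite in_itv/= => /andP[d0 de].
have -> : g 0 = 0 by rewrite /g addr0 subr0 subrr mulr0 mul0r subrr.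
have -> : g e = x `^ c - y `^ c - c * (x - y) * a `^ (c - 1).
  rewrite /g; congr (_ `^ _ - _ `^ _ - _ * _); rewrite /a /e; lra.
have : 0 <= dg d * (e - 0).
  rewrite subr0 mulr_ge0// /dg.
  have da : d < a by lra.
  have := @powRN_midpoint_convex (1 - c) a d ltac:(lra) d0 da; rewrite opprB; nra.
by move=> ? E; lra.
Qed.

(* A lower bound for the divided difference of spowR (p - 1) that depends on
   [|x| + |y|] only, even when [x] and [y] have opposite signs. *)
Lemma spowR_monotone p x y : 1 < p <= 2 ->
  (p - 1) * ((x - y) ^+ 2 * ((`|x| + `|y|) / 2) `^ (p - 2)) <=
  (spowR (p - 1) x - spowR (p - 1) y) * (x - y).
Proof.
move=> p12.
have c01 : 0 < p - 1 <= 1 by lra.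
have -> : p - 2 = p - 1 - 1 by ring.
move: (p - 1) c01 => c c01 {p12}; have /andP[c0 c1] := c01.
wlog yx : x y / `|y| <= `|x|.
  move=> H; have [|/ltW xy] := leP `|y| `|x|; first exact: H.
  by have := H _ _ xy; rewrite [`|x| + _]addrC; nra.
wlog x0 : x y yx / 0 <= x.
  move=> H; have [|/ltW xy] := leP 0 x; first exact: H.
  have := H (- x) (- y); rewrite /spowR !normrN !sgrN oppr_ge0 => /(_ yx xy).
  nra.
rewrite {1 2}/spowR.
have [y0|y0] := leP 0 y.
  rewrite (ger0_norm x0) (ger0_norm y0) in yx *.
  have sg z : 0 <= z -> Num.sg z * z `^ c = z `^ c.
    rewrite le_eqVlt => /predU1P[<-|z0]; last by rewrite gtr0_sg// mul1r.
    by rewrite powR0 ?gt_eqF// mulr0.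
  rewrite !sg//.
  have := @powR_secant c x y c01; rewrite y0 yx => /(_ isT); nra.
rewrite (ger0_norm x0) (ltr0_norm y0) in yx *.
have xy0 : 0 < x - y by lra.
rewrite (ltr0_sg y0) mulN1r opprK.
have x0' : 0 < x by lra.
rewrite gtr0_sg// mul1r.
(* For opposite signs, x and -y both lie below x - y = |x| + |y|. As c - 1 <= 0, enlarging the base
   from z/2 only weakens the secant bound at 0; the bounds for x and -y add up. *)
have H z : 0 < z -> z <= x - y -> c * z * ((x - y) / 2) `^ (c - 1) <= z `^ c.
  move=> z0 zx; apply: le_trans (powR_secant_at0 c01 (ltW z0)).
  rewrite ler_wpM2l//; first by rewrite mulr_ge0// ltW.
  by rewrite -[c - 1]opprB; apply: ler_powRN; lra.
have := H x x0' ltac:(lra); have := H (- y) ltac:(lra) ltac:(lra).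
by move: (_ `^ (c - 1)) (x `^ c) ((- y) `^ c) => k u v; nra.
Qed.

(** The tangent inequality at 1 for x/y, multiplied by y. *)
Lemma powR_amgm t x y : 0 < t < 1 -> 0 <= x -> 0 <= y ->
  x `^ t * y `^ (1 - t) <= t * x + (1 - t) * y.
Proof.
move=> /andP[t0 t1] x0; rewrite le_eqVlt => /predU1P[<-|y0].
  by rewrite powR0 ?mulr0 ?addr0; [rewrite mulr_ge0// ltW|rewrite subr_eq0 gt_eqF].
have t01 : 0 < t <= 1 by rewrite t0 ltW.
have xy0 : 0 <= x / y by rewrite divr_ge0// ltW.
have := powR_concave_tangent1 t01 xy0.
have yE : y = y `^ t * y `^ (1 - t).
  rewrite -powRD; last by rewrite (gt_eqF y0) implybT.
  by have -> : t + (1 - t) = 1; [ring|rewrite powRr1// ltW].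
move=> /(ler_wpM2r (ltW y0)); rewrite {2}yE mulrA -(powRM _ xy0 (ltW y0)) divfK ?gt_eqF//.
move=> /le_trans; apply; rewrite le_eqVlt; apply/orP; left; apply/eqP.
by field; rewrite gt_eqF.
Qed.

(** Hoelder with exponents 2/p and 2/(2-p) for the factorization |d|^p = (d^2 m^(p-2))^(p/2)
    (m^p)^(1-p/2). For p < 2 the power m^(p-2) takes the default value 0 at m = 0, so [d] has to
    vanish there. *)
Lemma reverse_holder (I : finType) (d m : I -> R) (S : R) p :
  1 < p <= 2 -> (forall i, 0 <= m i) -> (forall i, m i = 0 -> d i = 0) ->
  \sum_i m i `^ p <= S ->
  (\sum_i `|d i| `^ p) `^ (2 / p) <=
  (\sum_i d i ^+ 2 * m i `^ (p - 2)) * S `^ ((2 - p) / p).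
Proof.
move=> /andP[p1]; rewrite le_eqVlt => /predU1P[->|p2] m0 md mS.
  rewrite divff ?pnatr_eq0// subrr mul0r !powRr0 mulr1 powRr1; last first.
    by apply: sumr_ge0 => i _; exact: powR_ge0.
  by apply: ler_sum => i _; rewrite powRr0 mulr1 -real_normK ?num_real// powR_mulrn.
have p0 : 0 < p by lra.
set Q := \sum_i _ * _; set T := \sum_i _ `^ p.
have t01 : 0 < p / 2 < 1 by lra.
have q0 i : 0 <= d i ^+ 2 * m i `^ (p - 2) by rewrite mulr_ge0 ?sqr_ge0 ?powR_ge0.
have Q0 : 0 <= Q by exact: sumr_ge0.
have S0 : 0 <= S by apply: le_trans mS; apply: sumr_ge0 => i _; exact: powR_ge0.
have dE i : `|d i| `^ p = (d i ^+ 2 * m i `^ (p - 2)) `^ (p / 2) * (m i `^ p) `^ (1 - p / 2).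
  have [mi|mi] := eqVneq (m i) 0.
    by rewrite (md _ mi) normr0 !powR0 ?gt_eqF// expr0n/= mul0r powR0 ?mul0r// gt_eqF//; lra.
  rewrite powRM ?sqr_ge0 ?powR_ge0// -real_normK ?num_real// -powR_mulrn// -!powRrM.
  rewrite -mulrA -powRD ?mi ?implybT//.
  have -> : (p - 2) * (p / 2) + p * (1 - p / 2) = 0 by field.
  by rewrite powRr0 mulr1; congr powR; field.
(* Normalize the two factors by [Q] and [S] and apply the weighted mean inequality termwise; if [Q]
   or [S] is 0, so is [T]. *)
have TQS : T <= Q `^ (p / 2) * S `^ (1 - p / 2).
  have [Qz|Qn] := eqVneq Q 0.
    rewrite /T big1 ?mulr_ge0 ?powR_ge0// => i _; rewrite dE.
    have -> : d i ^+ 2 * m i `^ (p - 2) = 0.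
      by apply: (psumr_eq0P _ Qz).
    by rewrite powR0 ?mul0r// gt_eqF//; lra.
  have [Sz|Sn] := eqVneq S 0.
    rewrite /T big1 ?mulr_ge0 ?powR_ge0// => i _; rewrite dE.
    have -> : m i `^ p = 0.
      apply: (@psumr_eq0P _ _ predT (fun i => m i `^ p)) => //.
        by move=> *; exact: powR_ge0.
      apply/le_anti/andP; split; first by rewrite (le_trans mS)// Sz.
      by apply: sumr_ge0 => *; exact: powR_ge0.
    by rewrite [X in _ * X]powR0 ?mulr0// gt_eqF//; lra.
  have Qp : 0 < Q by rewrite lt_neqAle eq_sym Qn.
  have Sp : 0 < S by rewrite lt_neqAle eq_sym Sn.
  have : \sum_i ((d i ^+ 2 * m i `^ (p - 2)) / Q) `^ (p / 2) * (m i `^ p / S) `^ (1 - p / 2) <= 1.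
    have : \sum_i (p / 2 * ((d i ^+ 2 * m i `^ (p - 2)) / Q) + (1 - p / 2) * (m i `^ p / S)) <= 1.
      rewrite big_split/= -!mulr_sumr -!mulr_suml -/Q divff// mulr1.
      have : (\sum_i m i `^ p) / S <= 1 by rewrite ler_pdivrMr// mul1r.
      by nra.
    apply: le_trans; apply: ler_sum => i _.
    by apply: powR_amgm; rewrite ?divr_ge0 ?powR_ge0// ltW.
  have -> : \sum_i ((d i ^+ 2 * m i `^ (p - 2)) / Q) `^ (p / 2) * (m i `^ p / S) `^ (1 - p / 2)
      = T / (Q `^ (p / 2) * S `^ (1 - p / 2)).
    rewrite /T mulr_suml; apply: eq_bigr => i _; rewrite dE.
    rewrite !powR_div ?powR_ge0//.
    by field; rewrite !gt_eqF ?powR_gt0.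
  by rewrite ler_pdivrMr ?mulr_gt0 ?powR_gt0// mul1r.
have T0 : 0 <= T by apply: sumr_ge0 => i _; exact: powR_ge0.
have := @ge0_ler_powR R (2 / p) ltac:(by rewrite divr_ge0 ?ltW) T _ _ _ TQS.
rewrite !nnegrE T0 mulr_ge0 ?powR_ge0// => /(_ isT isT).
rewrite powRM ?powR_ge0// -!powRrM.
have -> : p / 2 * (2 / p) = 1 by field; rewrite gt_eqF.
rewrite powRr1//; congr (_ <= _ * _ `^ _).
by field; rewrite gt_eqF.
Qed.

Lemma young_scaled p q (a b x y : R) : 0 < p -> 0 < q -> p^-1 + q^-1 = 1 ->
  0 < a -> 0 < b ->
  x * y <= a * b * (`|x| `^ p / a `^ p / p + `|y| `^ q / b `^ q / q).
Proof.
move=> p0 q0 pq1 a0 b0; apply: (le_trans (ler_norm _)); rewrite normrM.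
have xa0 := divr_ge0 (normr_ge0 x) (ltW a0).
have yb0 := divr_ge0 (normr_ge0 y) (ltW b0).
have := conjugate_powR xa0 yb0 p0 q0 pq1.
rewrite (powR_div _ (normr_ge0 _) (ltW a0)) (powR_div _ (normr_ge0 _) (ltW b0)).
have ab0 : 0 < a * b by rewrite mulr_gt0.
rewrite -(ler_pM2l ab0); move: (_ / a `^ p / p + _) => u.
by congr (_ <= _); field; rewrite !gt_eqF.
Qed.

(** After division by the norms, Young's inequality is summed against [w]; unit row and column sums
    turn the right side into 1/p + 1/q = 1. The weights will be squared inner products of two
    eigenbases. *)
Lemma bistochastic_holder (I J : finType) (w : I -> J -> R) (x : I -> R)
    (y : J -> R) p : 1 < p ->
  (forall i j, 0 <= w i j) -> (forall i, \sum_j w i j = 1) ->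
  (forall j, \sum_i w i j = 1) ->
  \sum_i \sum_j w i j * (x i * y j) <=
  (\sum_i `|x i| `^ p) `^ p^-1 *
  (\sum_j `|y j| `^ (p / (p - 1))) `^ (p / (p - 1))^-1.
Proof.
move=> p1 w0 wr wc; have p0 : 0 < p by lra.
have pm0 : 0 < p - 1 by lra.
have pq1 : p^-1 + (p / (p - 1))^-1 = 1 by field; rewrite !gt_eqF.
have : 0 < p / (p - 1) by rewrite divr_gt0.
move: (p / (p - 1)) pq1 => q pq1 q0.
set M := \sum_i `|x i| `^ p; set N := \sum_j `|y j| `^ q.
have M0 : 0 <= M by apply: sumr_ge0 => i _; exact: powR_ge0.
have N0 : 0 <= N by apply: sumr_ge0 => i _; exact: powR_ge0.
have zero (K : finType) (r : R) (z : K -> R) :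
    \sum_k `|z k| `^ r = 0 -> forall k, z k = 0.
  move=> z0 k; apply/normr0_eq0/(@powR_eq0_eq0 _ _ r).
  by apply: (psumr_eq0P _ z0) => // j _; exact: powR_ge0.
have [/zero xz|Mn] := eqVneq M 0.
  rewrite big1 ?mulr_ge0 ?powR_ge0// => i _; rewrite big1// => j _.
  by rewrite xz mul0r mulr0.
have [/zero yz|Nn] := eqVneq N 0.
  rewrite big1 ?mulr_ge0 ?powR_ge0// => i _; rewrite big1// => j _.
  by rewrite yz !mulr0.
have Mp : 0 < M by rewrite lt_neqAle eq_sym Mn.
have Np : 0 < N by rewrite lt_neqAle eq_sym Nn.
have := powR_gt0 p^-1 Mp; have := powR_gt0 q^-1 Np.
have : (M `^ p^-1) `^ p = M by rewrite -powRrM mulVf ?gt_eqF// powRr1.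
have : (N `^ q^-1) `^ q = N by rewrite -powRrM mulVf ?gt_eqF// powRr1.
move: (M `^ p^-1) (N `^ q^-1) => a b bN aM b0 a0.
have young i j := young_scaled (x i) (y j) p0 q0 pq1 a0 b0.
apply: (@le_trans _ _ (a * b * (\sum_i \sum_j w i j * (`|x i| `^ p / M / p) +
    \sum_i \sum_j w i j * (`|y j| `^ q / N / q)))); last first.
  rewrite [X in _ + X]exchange_big/=.
  under eq_bigr do rewrite -mulr_suml wr mul1r.
  under [X in _ + X]eq_bigr do rewrite -mulr_suml wc mul1r.
  by rewrite -!mulr_suml !divff// !mul1r pq1 mulr1.
rewrite -big_split mulr_sumr; apply: ler_sum => i _ /=.
rewrite -big_split mulr_sumr; apply: ler_sum => j _ /=.
by rewrite -mulrDr [leRHS]mulrCA ler_wpM2l// -aM -bN.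
Qed.

End PowerInequalities.

(** * A geometric superposition of resolvents that approximates a negative power *)

Section ResolventSeries.
Variables (R : realType) (r th : R).
Hypotheses (r1 : 1 < r) (th01 : 0 < th < 1).
Implicit Types m s : R.

Let r0 : 0 < r. Proof. by rewrite (lt_trans ltr01). Qed.

(** The integrand, with respect to ds/s, of the integral of s^(-th) / (m + s) ds over s > 0, which
    is a constant multiple of m^(-th). It is sampled at the integer powers of [r]. *)
Definition resolvent_term s m := s `^ (1 - th) / (m + s).

(** Pairing the exponents n and -(n+1) turns the sum over all integers into a one-sided series. *)
Definition resolvent_pair m n :=
  resolvent_term (r ^+ n) m + resolvent_term (r ^- n.+1) m.

Definition resolvent_sum m := limn (series (resolvent_pair m)).

Lemma resolvent_term_ge0 s m : 0 <= s -> 0 <= m -> 0 <= resolvent_term s m.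
Proof. by move=> s0 m0; rewrite divr_ge0 ?powR_ge0 ?addr_ge0. Qed.

Lemma resolvent_pair_ge0 m n : 0 <= m -> 0 <= resolvent_pair m n.
Proof.
move=> m0; rewrite addr_ge0// resolvent_term_ge0// ?invr_ge0 exprn_ge0// ltW//.
Qed.

Lemma resolvent_term_scale s m : 0 < s -> 0 <= m ->
  resolvent_term (r * s) (r * m) = r `^ (- th) * resolvent_term s m.
Proof.
move=> s0 m0; rewrite /resolvent_term powRM ?ltW// [r `^ (1 - th)]powRD; last first.
  by rewrite (gt_eqF r0) implybT.
have ms : m + s != 0 by rewrite gt_eqF// ltr_wpDl.
rewrite powRr1 ?ltW// -mulrDr invfM; field.
by rewrite ms gt_eqF.
Qed.

(** The two halves are dominated by geometric series of ratios r^(-th) and r^(-(1-th)). *)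
Lemma is_cvg_resolvent_series m : 0 < m -> cvgn (series (resolvent_pair m)).
Proof.
move=> m0; have /andP[th0 th1] := th01.
have rX n : 0 < r ^+ n by rewrite exprn_gt0.
have powX n (s a : R) : 0 <= s -> (s ^+ n) `^ a = (s `^ a) ^+ n.
  by move=> s0; rewrite -(powR_mulrn n s0) -(powR_mulrn n (powR_ge0 _ _)) -!powRrM mulrC.
have geo (a b : R) : 0 <= a -> 0 <= b < 1 -> cvgn (series (geometric a b)).
  by move=> a0 /andP[b0 b1]; apply: is_cvg_geometric_series; rewrite ger0_norm.
have small (a : R) : 0 < a -> 0 <= r `^ (- a) < 1.
  move=> a0; rewrite powR_ge0/= powRN invf_lt1 ?powR_gt0//.
  by rewrite -(powRr0 r) /powR gt_eqF// ltr_expR ltr_pM2r ?ln_gt0.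
apply: is_cvg_seriesD.
  apply: (@series_le_cvg _ _ (geometric 1 (r `^ (- th)))).
  - by move=> n; apply: resolvent_term_ge0; rewrite ltW.
  - by move=> n; apply: geometric_ge0 => //; exact: powR_ge0.
  - move=> n /=; rewrite mul1r /resolvent_term -(powX _ _ _ (ltW r0)) ler_pdivrMr; last first.
      by rewrite addr_gt0.
    rewrite powRD; last by rewrite (gt_eqF (rX n)) implybT.
    by rewrite (powRr1 (ltW (rX n))) mulrC ler_wpM2l ?powR_ge0// lerDr ltW.
  - by apply: geo => //; exact: small.
apply: (@series_le_cvg _ _ (geometric (r `^ (- (1 - th)) / m) (r `^ (- (1 - th))))).
- by move=> n; apply: resolvent_term_ge0; rewrite ?invr_ge0 ltW.
- by move=> n; apply: geometric_ge0; rewrite ?divr_ge0 ?powR_ge0// ltW.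
- move=> n /=; rewrite /resolvent_term mulrAC -exprS powRN exprVn -(powX _ _ _ (ltW r0)).
  have -> : (r ^- n.+1) `^ (1 - th) = ((r ^+ n.+1) `^ (1 - th))^-1.
    by rewrite -[_^-1 in LHS]div1r (powR_div _ ler01 (ltW (rX _))) powR1 div1r.
  rewrite ler_wpM2l ?invr_ge0 ?powR_ge0//.
  by rewrite lef_pV2 ?posrE ?addr_gt0 ?invr_gt0// lerDl invr_ge0 ltW.
- by apply: geo; [rewrite divr_ge0 ?powR_ge0// ltW|apply: small; lra].
Qed.

Lemma resolvent_sum_scale m : 0 < m ->
  resolvent_sum (r * m) = r `^ (- th) * resolvent_sum m.
Proof.
move=> m0; have m0' := ltW m0.
pose z n := resolvent_term (r ^+ n) m; pose w n := resolvent_term (r ^- n.+1) m.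
have rX n : 0 < r ^+ n by rewrite exprn_gt0.
have rV n : 0 < r ^- n by rewrite invr_gt0.
have zS n : resolvent_term (r ^+ n.+1) (r * m) = r `^ (- th) * z n.
  by rewrite exprS resolvent_term_scale.
have wS n : resolvent_term (r ^- n.+1) (r * m) = r `^ (- th) * w n.+1.
  rewrite /w -resolvent_term_scale//; congr resolvent_term.
  by rewrite [r ^+ n.+2]exprS invfM mulVKf// gt_eqF.
have w0 : resolvent_term (r ^+ 0) (r * m) = r `^ (- th) * w 0%N.
  by rewrite /w -resolvent_term_scale// expr1 expr0 divff// gt_eqF.
(* Scaling m by [r] shifts the sample points by one, so the partial sums differ, up to the factor,
   by one term gained at the lower end and one lost at the upper end; both tend to 0. *)
have E n : series (resolvent_pair (r * m)) n.+1 =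
   r `^ (- th) * (series (resolvent_pair m) n.+1 + (w n.+1 - z n)).
  elim: n => [|n IH].
    rewrite !seriesEnat/= !big_nat1 /resolvent_pair w0 wS -/(z 0%N) -/(w 0%N); ring.
  rewrite !(seriesSr _ n.+1) IH [resolvent_pair (r * m) _]/resolvent_pair zS wS.
  rewrite [resolvent_pair m n.+1]/resolvent_pair -/(z n.+1) -/(w n.+1).
  by ring.
have cm := is_cvg_resolvent_series m0.
have u0 := cvg_series_cvg_0 cm.
have z0 : (z @ \oo --> 0)%classic.
  apply: (@squeeze_cvgr _ _ _ _ (cst 0) (resolvent_pair m)) => //.
    apply: nearW => n /=; apply/andP; split.
      by apply: resolvent_term_ge0; rewrite ?ltW.
    by rewrite /resolvent_pair lerDl; apply: resolvent_term_ge0; rewrite ?ltW.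
  exact: cvg_cst.
have w00 : (w @ \oo --> 0)%classic.
  apply: (@squeeze_cvgr _ _ _ _ (cst 0) (resolvent_pair m)) => //.
    apply: nearW => n /=; apply/andP; split.
      by apply: resolvent_term_ge0; rewrite ?ltW.
    by rewrite /resolvent_pair lerDr; apply: resolvent_term_ge0; rewrite ?ltW.
  exact: cvg_cst.
apply: cvg_lim => //.
rewrite -cvg_shiftS.
have -> : [sequence series (resolvent_pair (r * m)) n.+1]_n =
  (fun n => r `^ (- th) * (series (resolvent_pair m) n.+1 + (w n.+1 - z n))).
  by apply/funext.
apply: cvgMr.
rewrite -[resolvent_sum m]addr0; apply: cvgD.
  by rewrite (cvg_shiftS (series (resolvent_pair m))).
rewrite -[0]subr0; apply: cvgB => //.
by rewrite (cvg_shiftS w).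
Qed.

Lemma le_resolvent_sum m m' : 0 < m -> m <= m' ->
  resolvent_sum m' <= resolvent_sum m.
Proof.
move=> m0 mm; have m0' := lt_le_trans m0 mm.
apply: lim_series_le; [exact: is_cvg_resolvent_series..|move=> n].
have H s : 0 < s -> resolvent_term s m' <= resolvent_term s m.
  move=> s0; rewrite ler_wpM2l ?powR_ge0// lef_pV2 ?posrE ?addr_gt0//.
  by rewrite lerD2r.
by rewrite lerD// H ?invr_gt0 ?exprn_gt0.
Qed.

Lemma nondecreasing_resolvent_series m : 0 <= m ->
  nondecreasing_seq (series (resolvent_pair m)).
Proof.
by move=> m0; apply: nondecreasing_series => n _ _; exact: resolvent_pair_ge0.
Qed.

Lemma resolvent_sum_gt0 : 0 < resolvent_sum 1.
Proof.
have := nondecreasing_cvgn_le (nondecreasing_resolvent_series ler01)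
  (is_cvg_resolvent_series ltr01) 1%N.
apply: lt_le_trans; rewrite seriesEnat/= big_nat1 ltr_wpDr//.
  by rewrite resolvent_term_ge0// invr_ge0 exprn_ge0// ltW.
by rewrite divr_gt0 ?powR_gt0 ?addr_gt0 ?exprn_gt0.
Qed.

(** The scaling relation iterated upwards, or downwards by cancelling r^(-th); the exponential is
    r^z for an integer z of either sign. *)
Lemma resolvent_sum_int (z : int) :
  resolvent_sum (expR (z%:~R * ln r)) =
  expR (z%:~R * ln r) `^ (- th) * resolvent_sum 1.
Proof.
have step (x : R) : expR (ln r + x) = r * expR x by rewrite expRD lnK.
have H n : resolvent_sum (expR (n%:R * ln r)) =
  expR (n%:R * ln r) `^ (- th) * resolvent_sum 1.
  elim: n => [|n IH]; first by rewrite mul0r expR0 powR1 mul1r.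
  rewrite -natr1 mulrDl mul1r addrC step resolvent_sum_scale ?expR_gt0// IH.
  by rewrite powRM ?expR_ge0 ?ltW// mulrA.
case: z => n; first exact: H.
rewrite NegzE mulrNz -pmulrn; elim: (n.+1) => [|k IH].
  by rewrite oppr0 mul0r expR0 powR1 mul1r.
have := resolvent_sum_scale (expR_gt0 (- k.+1%:R * ln r)).
rewrite -step.
have -> : ln r + - k.+1%:R * ln r = - k%:R * ln r by rewrite -natr1; ring.
rewrite IH => E; apply: (@mulfI _ (r `^ (- th))).
  by rewrite gt_eqF// powR_gt0.
rewrite -E mulrA -powRM ?expR_ge0 ?ltW// -step.
by have -> : ln r + - k.+1%:R * ln r = - k%:R * ln r by rewrite -natr1; ring.
Qed.

(** Place m between consecutive integer powers of [r], where the sum is known exactly, and use that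
    the sum is nonincreasing in m; this costs at most a factor r^th either way. *)
Lemma resolvent_sum_bounds m : 0 < m ->
  r `^ (- th) * m `^ (- th) * resolvent_sum 1 <= resolvent_sum m
  <= r `^ th * m `^ (- th) * resolvent_sum 1.
Proof.
move=> m0; have /andP[th0 th1] := th01.
have lr : 0 < ln r by rewrite ln_gt0.
have /andP[] := floor_itv (ln m / ln r).
set z := Num.floor _; rewrite ler_pdivlMr// ltr_pdivrMr// => h1 h2.
set e := expR (z%:~R * ln r).
have e0 : 0 < e by exact: expR_gt0.
have em : e <= m by rewrite -(@lnK _ m)// ler_expR.
have me : m <= r * e.
  rewrite -(@lnK _ m)// -[r](@lnK _ r)// -expRD ler_expR ltW// (lt_le_trans h2)//.
  by rewrite intrD mulrDl mul1r addrC.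
have L1 := ltW resolvent_sum_gt0.
apply/andP; split.
  apply: le_trans (le_resolvent_sum m0 me).
  rewrite resolvent_sum_scale// resolvent_sum_int -/e mulrA ler_wpM2r//.
  by rewrite ler_wpM2l ?powR_ge0// ler_powRN// ltW.
apply: (le_trans (le_resolvent_sum e0 em)).
rewrite resolvent_sum_int -/e ler_wpM2r//.
have -> : e `^ (- th) = r `^ th * (r * e) `^ (- th).
  rewrite powRM ?ltW// mulrA -powRD ?subrr ?powRr0 ?mul1r//.
  by rewrite (gt_eqF r0) implybT.
by rewrite ler_wpM2l ?powR_ge0// ler_powRN// ltW.
Qed.

End ResolventSeries.

(** * From inequalities between resolvent sums to inequalities between negative powers *)

Section ResolventComparison.
Variable R : realType.

Lemma cvg_finsum (J : finType) (f : J -> nat -> R) (l : J -> R) :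
  (forall j, (f j @ \oo --> l j)%classic) ->
  ((fun n => \sum_j f j n) @ \oo --> \sum_j l j)%classic.
Proof.
move=> fl; elim: (index_enum J) => [|j s IH].
  rewrite big_nil; have -> : (fun n => \sum_(j <- [::]) f j n) = cst 0.
    by apply/funext => n; rewrite big_nil.
  exact: cvg_cst.
rewrite big_cons.
have -> : (fun n => \sum_(i <- j :: s) f i n) = (fun n => f j n + \sum_(i <- s) f i n).
  by apply/funext => n; rewrite big_cons.
exact: cvgD.
Qed.

(** As s tends to 0 a term with l j = 0 grows like b j / s, while the right side stays below [K];
    hence b j <= K s for every s > 0. *)
Lemma resolvent_pole_eq0 (I J : finType) (c m : I -> R) (b l : J -> R) :
  (forall i, 0 <= c i) -> (forall i, 0 <= m i) -> (forall i, m i = 0 -> c i = 0) ->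
  (forall j, 0 <= b j) -> (forall j, 0 <= l j) ->
  (forall s, 0 < s -> \sum_j b j / (l j + s) <= \sum_i c i / (m i + s)) ->
  forall j, l j = 0 -> b j = 0.
Proof.
move=> c0 m0 mc b0 l0 H j lj; set K := \sum_i c i / m i.
have K0 : 0 <= K by apply: sumr_ge0 => i _; rewrite divr_ge0.
have bK s : 0 < s -> b j <= K * s.
  move=> s0; rewrite -ler_pdivrMr//; apply: le_trans (le_trans (H s s0) _).
    rewrite (bigD1 j)//= lj add0r lerDl sumr_ge0// => k _.
    by rewrite divr_ge0// addr_ge0// ltW.
  apply: ler_sum => i _; have [/mc ->|mi] := eqVneq (m i) 0; first by rewrite !mul0r.
  have mi0 : 0 < m i by rewrite lt_neqAle eq_sym mi m0.
  by rewrite ler_wpM2l// lef_pV2 ?posrE ?addr_gt0// lerDl ltW.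
apply/le_anti/andP; split => //; apply/ler_addgt0Pr => e e0; rewrite add0r.
have K1 : 0 < K + 1 by rewrite ltr_wpDl.
have := bK (e / (K + 1)) (divr_gt0 e0 K1) => /le_trans; apply.
by rewrite mulrCA ger_pMr// ler_pdivrMr// mul1r lerDl.
Qed.

(* Up to a multiplicatively periodic factor tending to 1 with [r], the function
   [m |-> m `^ (- th)] is the superposition of resolvents [resolvent_sum r th]. *)
Lemma le_powRN_of_resolvent (I J : finType) (c m : I -> R) (b l : J -> R) th :
  0 <= th < 1 ->
  (forall i, 0 <= c i) -> (forall i, 0 <= m i) -> (forall i, m i = 0 -> c i = 0) ->
  (forall j, 0 <= b j) -> (forall j, 0 <= l j) -> (forall j, l j = 0 -> b j = 0) ->
  (forall s, 0 < s -> \sum_j b j / (l j + s) <= \sum_i c i / (m i + s)) ->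
  \sum_j b j * l j `^ (- th) <= \sum_i c i * m i `^ (- th).
Proof.
move=> /andP[]; rewrite le_eqVlt => /predU1P[<- _ |th0 th1] c0 m0 mc b0 l0 lb H.
  under eq_bigr do rewrite oppr0 powRr0 mulr1.
  under [leRHS]eq_bigr do rewrite oppr0 powRr0 mulr1.
  set X := \sum_j _; set Y := \sum_i _; set M := \sum_j l j.
  have Y0 : 0 <= Y by exact: sumr_ge0.
  have M0 : 0 <= M by exact: sumr_ge0.
  (* For [th] = 0 the claim compares total masses, which s times the resolvent sums approach as s
     grows; each l j is bounded by [M]. *)
  have XY s : 0 < s -> X / (M + s) <= Y / s.
    move=> s0; rewrite /X /Y !mulr_suml.
    apply: le_trans (le_trans (H s s0) _); apply: ler_sum => j _.
      rewrite ler_wpM2l// lef_pV2 ?posrE ?ltr_wpDl// lerD2r.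
      by rewrite /M (bigD1 j)//= lerDl sumr_ge0.
    by rewrite ler_wpM2l// lef_pV2 ?posrE ?ltr_wpDl// lerDr.
  apply/ler_addgt0Pr => e e0.
  (* This s is large enough for the error Y M / s to be at most e. *)
  have s0 : 0 < (Y * M + 1) / e by rewrite divr_gt0 ?ltr_wpDl ?mulr_ge0.
  have := XY _ s0; set s := _ / e in s0 *.
  rewrite ler_pdivrMr ?ltr_wpDl// mulrAC ler_pdivlMr//.
  have : s * e = Y * M + 1 by rewrite /s divfK ?gt_eqF.
  by move=> sE X1; rewrite -(ler_pM2r s0); nra.
set X := \sum_j _; set Y := \sum_i _.
have Y0 : 0 <= Y by apply: sumr_ge0 => i _; rewrite mulr_ge0 ?powR_ge0.
have th01 : 0 < th < 1 by rewrite th0.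
(* Replacing the power by the resolvent sum costs a factor r^th on each side of the comparison. *)
have XY r : 1 < r -> X <= r `^ th * r `^ th * Y.
  move=> r1; have r0 : 0 < r by rewrite (lt_trans ltr01).
  have term s : 0 < s -> \sum_j b j * resolvent_term th s (l j) <=
                         \sum_i c i * resolvent_term th s (m i).
    move=> /H /(ler_wpM2l (powR_ge0 s (1 - th))).
    rewrite !mulr_sumr; congr (_ <= _); apply: eq_bigr => j _;
      by rewrite /resolvent_term mulrCA.
  have partial n : \sum_j b j * series (resolvent_pair r th (l j)) n <=
                   \sum_i c i * series (resolvent_pair r th (m i)) n.
    under eq_bigr do rewrite seriesEnat/= mulr_sumr.
    under [leRHS]eq_bigr do rewrite seriesEnat/= mulr_sumr.
    rewrite exchange_big [leRHS]exchange_big/=; apply: ler_sum => k _.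
    under eq_bigr do rewrite mulrDr.
    under [leRHS]eq_bigr do rewrite mulrDr.
    by rewrite !big_split; apply: lerD; apply: term; rewrite ?invr_gt0 exprn_gt0.
  have lim (K : finType) (a w : K -> R) : (forall k, 0 <= w k) ->
      (forall k, w k = 0 -> a k = 0) ->
      ((fun n => \sum_k a k * series (resolvent_pair r th (w k)) n) @ \oo -->
        \sum_k a k * resolvent_sum r th (w k))%classic.
    move=> w0 wa; apply: cvg_finsum => k.
    have [/wa ->|wk] := eqVneq (w k) 0.
      have -> : (fun n => 0 * series (resolvent_pair r th (w k)) n) = cst 0.
        by apply/funext => n; rewrite mul0r.
      rewrite mul0r; exact: cvg_cst.
    apply: cvgMr; apply: is_cvg_resolvent_series => //.
    by rewrite lt_neqAle eq_sym wk w0.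
  have bc : \sum_j b j * resolvent_sum r th (l j) <=
            \sum_i c i * resolvent_sum r th (m i).
    apply: ler_cvg_to (lim _ b l l0 lb) (lim _ c m m0 mc) _.
    by apply: nearW => n; exact: partial.
  have L1 := resolvent_sum_gt0 r1 th01.
  have lo : X * (r `^ (- th) * resolvent_sum r th 1) <=
            \sum_j b j * resolvent_sum r th (l j).
    rewrite mulr_suml; apply: ler_sum => j _.
    have [/lb ->|lj] := eqVneq (l j) 0; first by rewrite !mul0r.
    have lj0 : 0 < l j by rewrite lt_neqAle eq_sym lj l0.
    have /andP[h _] := resolvent_sum_bounds r1 th01 lj0.
    by have := ler_wpM2l (b0 j) h; congr (_ <= _); ring.
  have up : \sum_i c i * resolvent_sum r th (m i) <=
            Y * (r `^ th * resolvent_sum r th 1).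
    rewrite mulr_suml; apply: ler_sum => j _.
    have [/mc ->|lj] := eqVneq (m j) 0; first by rewrite !mul0r.
    have lj0 : 0 < m j by rewrite lt_neqAle eq_sym lj m0.
    have /andP[_ h] := resolvent_sum_bounds r1 th01 lj0.
    by have := ler_wpM2l (c0 j) h; congr (_ <= _); ring.
  have := le_trans lo (le_trans bc up).
  rewrite !mulrA ler_pM2r// powRN ler_pdivrMr ?powR_gt0//.
  by congr (_ <= _); ring.
apply/ler_addgt0Pr => e e0.
pose d := e / (Y + 1).
have d0 : 0 < d by rewrite divr_gt0 ?ltr_wpDl.
(* With this ratio the loss r^(2 th) is exactly 1 + d, and d Y <= e. *)
have r1 : 1 < (1 + d) `^ (2 * th)^-1.
  rewrite -[ltLHS](_ : 1 `^ (2 * th)^-1 = 1); last by rewrite powR1.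
  apply: gt0_ltr_powR.
  - by rewrite invr_gt0 mulr_gt0.
  - by rewrite nnegrE.
  - by rewrite nnegrE addr_ge0// ltW.
  - by rewrite ltrDl.
have := XY _ r1; rewrite -powRD; last by rewrite gt_eqF ?implybT ?powR_gt0 ?addr_gt0.
rewrite -powRrM; have -> : (2 * th)^-1 * (th + th) = 1 by field; rewrite gt_eqF.
rewrite powRr1; last by rewrite addr_ge0// ltW.
move=> /le_trans; apply.
rewrite mulrDl mul1r lerD2l /d mulrAC ler_pdivrMr ?ltr_wpDl//.
by rewrite ler_pM2l// lerDl.
Qed.

End ResolventComparison.

(** * Real-valued squared modulus of complex numbers *)

Section SquaredModulus.
Variable R : realType.
Implicit Types z : R[i].

Definition nsq z : R := complex.Re z ^+ 2 + complex.Im z ^+ 2.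

Lemma nsqE z : z * Num.conj z = (nsq z)%:C.
Proof. by rewrite -normCK /nsq add_Re2_Im2. Qed.

Lemma nsq_ge0 z : 0 <= nsq z.
Proof. by rewrite addr_ge0 ?sqr_ge0. Qed.

Lemma nsq_conj z : nsq (Num.conj z) = nsq z.
Proof. by apply: complexI; rewrite -!nsqE conjCK mulrC. Qed.

Lemma nsq_realM (t : R) z : nsq (t%:C * z) = t ^+ 2 * nsq z.
Proof. by case: z => x y; rewrite /nsq /=; simpc; ring. Qed.

Lemma ReD (x y : R[i]) : complex.Re (x + y) = complex.Re x + complex.Re y.
Proof. by case: x; case: y. Qed.

Lemma ReN (x : R[i]) : complex.Re (- x) = - complex.Re x.
Proof. by case: x. Qed.

Lemma conj_real (x : R) : Num.conj (x%:C) = x%:C :> R[i].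
Proof. by apply/CrealP; rewrite complex_real. Qed.

(* The polarised form of [0 <= nsq (t z - z')]. *)
Lemma nsq_polar z z' (t : R) : 0 < t ->
  nsq (z + z') - nsq z - nsq z' - nsq z * t <= nsq z' / t.
Proof.
move=> t0; rewrite ler_pdivlMr//.
case: z => a b; case: z' => c d; rewrite /nsq /=.
have := sqr_ge0 (a * t - c); have := sqr_ge0 (b * t - d).
nra.
Qed.

End SquaredModulus.

(** * Identities for unitary conjugation *)

Section UnitaryConjugation.
Variables (C : numClosedFieldType) (n : nat).
Implicit Types (U V a b D E X : 'M[C]_n).

Lemma unitary_adj_mul U : U \is unitarymx -> U^t* *m U = 1%:M.
Proof. by move=> Uu; rewrite -(invmx_unitary Uu) mulVmx// unitarymx_unit. Qed.

Lemma unitary_mul_adj U V : U \is unitarymx -> V \is unitarymx ->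
  U *m V^t* \is unitarymx.
Proof. by move=> Uu Vu; apply: mul_unitarymx; rewrite ?trmxC_unitary. Qed.

Lemma conj_diag_mul U D E : U \is unitarymx ->
  (U^t* *m D *m U) *m (U^t* *m E *m U) = U^t* *m (D *m E) *m U.
Proof. by move=> Uu; rewrite !mulmxA mulmxtVK. Qed.

Lemma conj_diag_scale k U D : k *: (U^t* *m D *m U) = U^t* *m (k *: D) *m U.
Proof. by rewrite scalemxAl scalemxAr. Qed.

Lemma mulmxBB X V D E :
  (X - V) *m (D - E) = X *m D - X *m E - (V *m D - V *m E).
Proof. by rewrite mulmxBl !mulmxBr. Qed.

Lemma mxtrace_unitary_conj U D : U \is unitarymx -> \tr (U^t* *m D *m U) = \tr D.
Proof.
by move=> /unitarymxP Uu; rewrite -mulmxA mxtrace_mulC -mulmxA Uu mulmx1.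
Qed.

Lemma mxtrace_conj_mul U V D E : \tr ((U^t* *m D *m U) *m (V^t* *m E *m V)) =
  \tr (D *m ((U *m V^t*) *m E *m (U *m V^t*)^t*)).
Proof. by rewrite -!mulmxA mxtrace_mulC adjmxM adjmxK !mulmxA. Qed.

Lemma gram_two_sided k m (a : 'M[C]_(k, m)) (D : 'M[C]_(m, n)) b :
  b \is unitarymx ->
  (a *m D *m b^t*) *m (a *m D *m b^t*)^t* = a *m (D *m D^t*) *m a^t*.
Proof.
move=> bu; rewrite !adjmxM adjmxK !mulmxA -(mulmxA _ (b^t*)).
by rewrite unitary_adj_mul// mulmx1.
Qed.

Lemma two_sided_basis U V G D :
  (U *m G^t*) *m D *m (V *m G^t*)^t* = U *m (G^t* *m D *m G) *m V^t*.
Proof. by rewrite adjmxM adjmxK !mulmxA. Qed.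

Lemma two_sidedB U V D E :
  U *m (D - E) *m V = U *m D *m V - U *m E *m V.
Proof. by rewrite mulmxBr mulmxBl. Qed.

Lemma two_sided_left U V D : U \is unitarymx ->
  U *m (U^t* *m D *m U) *m V^t* = D *m (U *m V^t*).
Proof. by move=> /unitarymxP Uu; rewrite !mulmxA Uu mul1mx. Qed.

Lemma two_sided_right U V D : V \is unitarymx ->
  U *m (V^t* *m D *m V) *m V^t* = U *m V^t* *m D.
Proof. by move=> Vu; rewrite !mulmxA mulmxtVK. Qed.

End UnitaryConjugation.

(** * Real diagonal matrices, unitary bases and Hermitian matrices *)

HB.lock Definition rdiag (R : realType) n (d : 'I_n -> R) : 'M[R[i]]_n :=
  diag_mx (\row_i (d i)%:C).

(** The columns of [U^t*] are the eigenvectors, so the entries of [U *m V^t*] are the inner products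
    between two eigenbases. *)
HB.lock Definition hdiag (R : realType) n (U : 'M[R[i]]_n) (d : 'I_n -> R) :
    'M[R[i]]_n :=
  U^t* *m rdiag d *m U.

Section RealDiag.
Variables (R : realType) (n : nat).
Implicit Types (U V W a b : 'M[R[i]]_n) (d e w x y : 'I_n -> R).

Lemma rdiagE d : rdiag d = diag_mx (\row_i (d i)%:C).
Proof. by rewrite rdiag.unlock. Qed.

Lemma hdiagE U d : hdiag U d = U^t* *m rdiag d *m U.
Proof. by rewrite hdiag.unlock. Qed.

Lemma adj_rdiag d : (rdiag d)^t* = rdiag d.
Proof.
rewrite rdiagE; apply/matrixP => i j; rewrite !mxE eq_sym.
by case: eqP => [->|_]; rewrite ?mulr1n ?mulr0n ?conjC0// conj_real.
Qed.

Lemma adj_hdiag U d : (hdiag U d)^t* = hdiag U d.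
Proof. by rewrite hdiagE !adjmxM adjmxK adj_rdiag mulmxA. Qed.

Lemma rdiagM d e : rdiag d *m rdiag e = rdiag (fun i => d i * e i).
Proof.
rewrite !rdiagE mulmx_diag; congr diag_mx.
by apply/rowP => i; rewrite !mxE rmorphM.
Qed.

Lemma rdiagD d e : rdiag d + rdiag e = rdiag (fun i => d i + e i).
Proof.
rewrite !rdiagE; apply/matrixP => i j; rewrite !mxE.
by case: eqP => _; rewrite ?mulr1n ?mulr0n ?addr0// rmorphD.
Qed.

Lemma hdiagM U d e : U \is unitarymx ->
  hdiag U d *m hdiag U e = hdiag U (fun i => d i * e i).
Proof. by move=> Uu; rewrite !hdiagE (conj_diag_mul _ _ Uu) rdiagM. Qed.

Lemma scale_hdiag (t : R) U d : t%:C *: hdiag U d = hdiag U (fun i => t * d i).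
Proof.
rewrite !hdiagE conj_diag_scale (_ : _ *: rdiag d = rdiag (fun i => t * d i))//.
rewrite !rdiagE.
apply/matrixP => i j; rewrite !mxE.
by case: eqP => _; rewrite ?mulr1n ?mulr0n ?mulr0// rmorphM.
Qed.

(** A Hermitian matrix is normal, hence unitarily diagonalizable; its diagonal form is again
    Hermitian, so the eigenvalues are real. *)
Lemma hermitian_hdiag (X : 'M[R[i]]_n) : X^t* = X ->
  exists U d, U \is unitarymx /\ X = hdiag U d.
Proof.
move=> Xh; have Xn : X \is normalmx by apply/normalmxP; rewrite Xh.
have /orthomx_spectralP XE := Xn.
exists (spectralmx X), (fun i => complex.Re (spectral_diag X 0 i)).
split; first exact: spectral_unitarymx.
have Uu := spectral_unitarymx X.
have DE : diag_mx (spectral_diag X) = spectralmx X *m X *m (spectralmx X)^t*.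
  rewrite -(invmx_unitary Uu) {3}XE !mulmxA mulmxV ?spectral_unit// mul1mx.
  by rewrite mulmxK ?spectral_unit.
suff dE : spectral_diag X = \row_i (complex.Re (spectral_diag X 0 i))%:C.
  by rewrite hdiagE rdiagE -dE -(invmx_unitary Uu).
apply/rowP => i; rewrite mxE.
have /matrixP/(_ i i) : (diag_mx (spectral_diag X))^t* = diag_mx (spectral_diag X).
  by rewrite DE !adjmxM adjmxK Xh mulmxA.
rewrite !mxE eqxx !mulr1n => /CrealP dr.
by rewrite RRe_real.
Qed.

Lemma herm_calc_hdiag (f : R -> R) U d : U \is unitarymx ->
  herm_calc f (hdiag U d) = hdiag U (f \o d).
Proof.
move=> Uu; rewrite (@herm_calcE _ _ f U (hdiag U d) (\row_i (d i)%:C)).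
- rewrite hdiagE rdiagE (invmx_unitary Uu) (_ : map_mx _ _ = \row_i (f (d i))%:C)//.
  by apply/rowP => i; rewrite !mxE.
- exact: unitarymx_unit.
- by apply/normalmxP; rewrite adj_hdiag.
- by rewrite hdiagE rdiagE (invmx_unitary Uu).
Qed.

Lemma mul_rdiag_adj_diag W d i :
  (W *m rdiag d *m W^t*) i i = (\sum_k nsq (W i k) * d k)%:C.
Proof.
rewrite mxE rmorph_sum; apply: eq_bigr => k _.
by rewrite rdiagE mul_mx_diag !mxE mulrAC nsqE -rmorphM.
Qed.

Lemma row_sum_nsq a b w i : b \is unitarymx ->
  \sum_j nsq ((a *m rdiag w *m b^t*) i j) = \sum_k nsq (a i k) * w k ^+ 2.
Proof.
move=> bu; apply: complexI; set W := _ *m _.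
have -> : (\sum_j nsq (W i j))%:C = (W *m W^t*) i i.
  by rewrite mxE rmorph_sum; apply: eq_bigr => k _; rewrite !mxE nsqE.
rewrite -mul_rdiag_adj_diag (gram_two_sided a (rdiag w) bu) adj_rdiag rdiagM.
by rewrite (_ : (fun k => w k * w k) = fun k => w k ^+ 2)//; apply/funext.
Qed.

Lemma nsq_adj W i j : nsq (W^t* i j) = nsq (W j i).
Proof. by rewrite !mxE nsq_conj. Qed.

Lemma col_sum_nsq a b w j : a \is unitarymx ->
  \sum_i nsq ((a *m rdiag w *m b^t*) i j) = \sum_k nsq (b j k) * w k ^+ 2.
Proof.
move=> au; rewrite -(row_sum_nsq b w j au); apply: eq_bigr => i _.
by rewrite -nsq_adj !adjmxM adjmxK adj_rdiag mulmxA.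
Qed.

Lemma unitary_row_sum W i : W \is unitarymx -> \sum_j nsq (W i j) = 1.
Proof.
move=> /unitarymxP/matrixP/(_ i i); rewrite !mxE eqxx => H.
apply: complexI; rewrite rmorph_sum -[RHS]H; apply: eq_bigr => k _.
by rewrite !mxE nsqE.
Qed.

Lemma unitary_col_sum W j : W \is unitarymx -> \sum_i nsq (W i j) = 1.
Proof.
rewrite -trmxC_unitary => /(unitary_row_sum j) <-.
by apply: eq_bigr => i _; rewrite nsq_adj.
Qed.

Lemma sum_unitary_row W d : W \is unitarymx ->
  \sum_i \sum_j nsq (W i j) * d i = \sum_i d i.
Proof.
by move=> Wu; apply: eq_bigr => i _; rewrite -mulr_suml unitary_row_sum ?mul1r.
Qed.

Lemma sum_unitary_col W d : W \is unitarymx ->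
  \sum_i \sum_j nsq (W i j) * d j = \sum_i d i.
Proof.
move=> Wu; rewrite exchange_big; apply: eq_bigr => j _.
by rewrite -mulr_suml unitary_col_sum ?mul1r.
Qed.

Lemma tr_hdiag U d : U \is unitarymx -> \tr (hdiag U d) = (\sum_i d i)%:C.
Proof.
move=> Uu; rewrite hdiagE (mxtrace_unitary_conj _ Uu) rdiagE mxtrace_diag rmorph_sum.
by apply: eq_bigr => i _; rewrite mxE.
Qed.

Lemma tr_hdiagM U V d e : \tr (hdiag U d *m hdiag V e) =
  (\sum_i \sum_j nsq ((U *m V^t*) i j) * (d i * e j))%:C.
Proof.
set W := U *m V^t*.
rewrite !hdiagE (mxtrace_conj_mul U V) -/W.
rewrite /mxtrace rmorph_sum; apply: eq_bigr => i _.
rewrite [rdiag d]rdiagE mul_diag_mx mxE mul_rdiag_adj_diag mxE -rmorphM mulr_sumr.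
by congr (_%:C); apply: eq_bigr => j _; ring.
Qed.

(* The quadratic form is tested against the matrix with the same singular bases
   and the coefficients [d k / (l k + s)], [l k] being the averages on the left. *)
Lemma resolvent_compression a b d x y s :
  a \is unitarymx -> b \is unitarymx ->
  (forall i, 0 <= x i) -> (forall i, 0 <= y i) -> 0 < s ->
  \sum_k d k ^+ 2 /
    ((\sum_i nsq (a i k) * x i + \sum_j nsq (b j k) * y j) / 2 + s) <=
  \sum_i \sum_j nsq ((a *m rdiag d *m b^t*) i j) / ((x i + y j) / 2 + s).
Proof.
move=> au bu x0 y0 s0.
pose l k := (\sum_i nsq (a i k) * x i + \sum_j nsq (b j k) * y j) / 2.
have l0 k : 0 <= l k.
  by rewrite divr_ge0// addr_ge0// sumr_ge0// => i _; rewrite mulr_ge0 ?nsq_ge0.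
pose w k := d k / (l k + s).
set D := a *m rdiag d *m b^t*; set W := a *m rdiag w *m b^t*.
pose t i j := (x i + y j) / 2 + s.
have t0 i j : 0 < t i j by rewrite /t ltr_wpDl// divr_ge0// addr_ge0.
have WD : W + D = a *m rdiag (fun k => w k + d k) *m b^t*.
  by rewrite -rdiagD mulmxDr mulmxDl.
(* Entrywise, |D|^2 / t is at least twice the real inner product of W and D minus |W|^2 t. Writing
   the cross term through |W + D|^2 leaves only sums of squared moduli. *)
apply: (@le_trans _ _ (\sum_i \sum_j (nsq ((W + D) i j) - nsq (W i j) -
    nsq (D i j) - nsq (W i j) * t i j))); last first.
  apply: ler_sum => i _; apply: ler_sum => j _; rewrite [X in nsq X]mxE.
  exact: nsq_polar.
have total v : \sum_i \sum_j nsq ((a *m rdiag v *m b^t*) i j) = \sum_k v k ^+ 2.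
  under eq_bigr do rewrite row_sum_nsq//.
  exact: (sum_unitary_col (fun k => v k ^+ 2) au).
(* The weight [t] splits into a row part and a column part, so only row and column sums of |W|^2
   occur; these produce the averages [l]. *)
have Wt : \sum_i \sum_j nsq (W i j) * t i j = \sum_k w k ^+ 2 * (l k + s).
  transitivity ((\sum_i (\sum_j nsq (W i j)) * x i) / 2 +
     (\sum_j (\sum_i nsq (W i j)) * y j) / 2 + (\sum_i \sum_j nsq (W i j)) * s).
    rewrite [X in _ + X / 2 + _](eq_bigr (fun j => \sum_i nsq (W i j) * y j)); last first.
      by move=> j _; rewrite mulr_suml.
    rewrite [X in _ + X / 2 + _]exchange_big !mulr_suml -!big_split/=.
    apply: eq_bigr => i _; rewrite !mulr_suml -!big_split/=.
    by apply: eq_bigr => j _; rewrite /t; ring.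
  under eq_bigr do rewrite row_sum_nsq// mulr_suml.
  under [X in _ + X / 2 + _]eq_bigr do rewrite col_sum_nsq// mulr_suml.
  rewrite total exchange_big [X in _ + X / 2 + _]exchange_big !mulr_suml -!big_split/=.
  apply: eq_bigr => k _; rewrite /l.
  have E (c z : 'I_n -> R) (q : R) : \sum_i c i * q * z i = q * \sum_i c i * z i.
    by rewrite mulr_sumr; apply: eq_bigr => i _; rewrite mulrCA mulrA.
  rewrite (E (fun i => nsq (a i k)) x) (E (fun i => nsq (b i k)) y).
  move: (w k ^+ 2) (\sum_i _) (\sum_j _) => q u v.
  by rewrite [RHS]mulrDr !mulrA mulrDr mulrDl.
have -> : \sum_i \sum_j (nsq ((W + D) i j) - nsq (W i j) - nsq (D i j) -
    nsq (W i j) * t i j) = \sum_i \sum_j nsq ((W + D) i j) -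
    \sum_i \sum_j nsq (W i j) - \sum_i \sum_j nsq (D i j) -
    \sum_i \sum_j nsq (W i j) * t i j.
  by rewrite -!sumrB; apply: eq_bigr => i _; rewrite -!sumrB.
have WDt : \sum_i \sum_j nsq ((W + D) i j) = \sum_k (w k + d k) ^+ 2.
  by rewrite WD; exact: total.
rewrite Wt WDt (total w : \sum_i \sum_j nsq (W i j) = _).
rewrite (total d : \sum_i \sum_j nsq (D i j) = _) -!sumrB; apply: ler_sum => k _.
(* What remains is 2 w d - w^2 (l + s), which is d^2 / (l + s) for the chosen w. *)
rewrite -/(l k) /w; have ls : l k + s != 0 by rewrite gt_eqF// ltr_wpDl.
by move: (l k + s) ls => v v0; rewrite le_eqVlt; apply/orP; left; apply/eqP; field.
Qed.

End RealDiag.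

(** * Trace powers of Hermitian matrices and monotonicity of the signed power *)

HB.lock Definition retr (R : realType) n (X : 'M[R[i]]_n) : R :=
  complex.Re (\tr X).

(** For Hermitian [X] and p > 0, the p-th power of the Schatten norm, read off the spectrum of [X]
    without passing through [absmx]. *)
HB.lock Definition trpow (R : realType) n (p : R) (X : 'M[R[i]]_n) : R :=
  retr (herm_calc (fun x => `|x| `^ p) X).

HB.lock Definition signed_pow (R : realType) n (p : R) (X : 'M[R[i]]_n) :
    'M[R[i]]_n :=
  herm_calc (spowR p) X.

Section TracePower.
Variables (R : realType) (n : nat).
Implicit Types (X Y P Q U V : 'M[R[i]]_n) (p t : R) (d : 'I_n -> R).

Lemma retrE X : retr X = complex.Re (\tr X).
Proof. by rewrite retr.unlock. Qed.

Lemma trpowE p X : trpow p X = retr (herm_calc (fun x => `|x| `^ p) X).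
Proof. by rewrite trpow.unlock. Qed.

Lemma signed_powE p X : signed_pow p X = herm_calc (spowR p) X.
Proof. by rewrite signed_pow.unlock. Qed.

Lemma retrD X Y : retr (X + Y) = retr X + retr Y.
Proof. by rewrite !retrE mxtraceD ReD. Qed.

Lemma retrN X : retr (- X) = - retr X.
Proof. by rewrite !retrE -scaleN1r mxtraceZ mulN1r ReN. Qed.

Lemma retrB X Y : retr (X - Y) = retr X - retr Y.
Proof. by rewrite retrD retrN. Qed.

Lemma retr_mulBB X Y P Q : retr ((X - Y) *m (P - Q)) =
  retr (X *m P) - retr (X *m Q) - (retr (Y *m P) - retr (Y *m Q)).
Proof.
rewrite mulmxBB; move: (X *m P) (X *m Q) (Y *m P) (Y *m Q) => A B C D.
by rewrite !retrB.
Qed.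

Lemma retrC X Y : retr (X *m Y) = retr (Y *m X).
Proof. by rewrite !retrE mxtrace_mulC. Qed.

Lemma retrZ t X : retr (t%:C *: X) = t * retr X.
Proof. by rewrite !retrE mxtraceZ; case: (\tr X) => x y /=; ring. Qed.

Lemma trpow_hdiag p U d : U \is unitarymx ->
  trpow p (hdiag U d) = \sum_i `|d i| `^ p.
Proof. by move=> Uu; rewrite trpowE (herm_calc_hdiag _ _ Uu) retrE (tr_hdiag _ Uu). Qed.

Lemma retr_hdiagM U V d e : retr (hdiag U d *m hdiag V e) =
  \sum_i \sum_j nsq ((U *m V^t*) i j) * (d i * e j).
Proof. by rewrite retrE tr_hdiagM. Qed.

Lemma retr_hdiagM_diag U d e : U \is unitarymx ->
  retr (hdiag U d *m hdiag U e) = \sum_i d i * e i.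
Proof.
move=> Uu; rewrite -[RHS]/(complex.Re ((\sum_i d i * e i)%:C)) -(tr_hdiag _ Uu).
by rewrite (hdiagM d e Uu) retrE.
Qed.

Lemma trpow_ge0 p X : X^t* = X -> 0 <= trpow p X.
Proof.
move=> /hermitian_hdiag[U [d [Uu ->]]]; rewrite (trpow_hdiag _ _ Uu) sumr_ge0// => i _.
exact: powR_ge0.
Qed.

Lemma signed_pow_hermitian p X : X^t* = X -> (signed_pow p X)^t* = signed_pow p X.
Proof.
by move=> /hermitian_hdiag[U [d [Uu ->]]]; rewrite !signed_powE (herm_calc_hdiag _ _ Uu) adj_hdiag.
Qed.

Lemma trpow_scale p t X : X^t* = X -> trpow p (t%:C *: X) = `|t| `^ p * trpow p X.
Proof.
move=> /hermitian_hdiag[U [d [Uu ->]]].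
rewrite (scale_hdiag t U d) (trpow_hdiag p (fun i => t * d i) Uu) (trpow_hdiag p d Uu).
by rewrite mulr_sumr; apply: eq_bigr => i _; rewrite normrM powRM.
Qed.

Lemma schatten_hermitian p X : X^t* = X -> schatten p X = trpow p X `^ p^-1.
Proof.
move=> Xh; have [U [d [Uu XE]]] := hermitian_hdiag Xh.
rewrite /schatten /absmx Xh.
have -> : X *m X = hdiag U (fun i => d i * d i).
  by rewrite {1 2}XE; exact: hdiagM.
rewrite !(herm_calc_hdiag _ _ Uu) (tr_hdiag _ Uu) XE (trpow_hdiag _ _ Uu)/=.
by congr (_ `^ _); apply: eq_bigr => i _; rewrite -expr2 sqrtr_sqr.
Qed.

(** Klein's inequality: the scalar tangent inequality at each pair of eigenvalues, weighted by the
    squared inner products of the eigenvectors. It makes p times [signed_pow] a subgradient of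
    [trpow]. *)
Lemma klein p X Y : 1 < p -> X^t* = X -> Y^t* = Y ->
  trpow p X + p * retr (signed_pow (p - 1) X *m (Y - X)) <= trpow p Y.
Proof.
move=> p1 /hermitian_hdiag[U [x [Uu ->]]] /hermitian_hdiag[V [y [Vu ->]]].
have Wu := unitary_mul_adj Uu Vu.
rewrite mulmxBr retrB signed_powE (herm_calc_hdiag _ _ Uu) retr_hdiagM.
rewrite (retr_hdiagM_diag _ _ Uu) (trpow_hdiag _ _ Uu) (trpow_hdiag _ _ Vu) /=.
rewrite -(sum_unitary_row (fun i => `|x i| `^ p) Wu).
rewrite -(sum_unitary_col (fun i => `|y i| `^ p) Wu).
rewrite -(sum_unitary_row (fun i => spowR (p - 1) (x i) * x i) Wu).
rewrite -sumrB mulr_sumr -big_split; apply: ler_sum => i _ /=.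
rewrite -sumrB mulr_sumr -big_split; apply: ler_sum => j _ /=.
have := ler_wpM2l (nsq_ge0 ((U *m V^t*) i j)) (normr_powR_tangent (x i) (y j) p1).
by apply: le_trans; rewrite le_eqVlt; apply/orP; left; apply/eqP; ring.
Qed.

Lemma retr_mixed_difference U V (d e x y : 'I_n -> R) :
  U \is unitarymx -> V \is unitarymx ->
  retr ((hdiag U d - hdiag V e) *m (hdiag U x - hdiag V y)) =
  \sum_i \sum_j nsq ((U *m V^t*) i j) * ((d i - e j) * (x i - y j)).
Proof.
move=> Uu Vu; have Wu := unitary_mul_adj Uu Vu.
rewrite retr_mulBB.
transitivity (\sum_i \sum_j nsq ((U *m V^t*) i j) * (d i * x i) -
  \sum_i \sum_j nsq ((U *m V^t*) i j) * (d i * y j) -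
  (\sum_i \sum_j nsq ((U *m V^t*) i j) * (x i * e j) -
   \sum_i \sum_j nsq ((U *m V^t*) i j) * (e j * y j))).
  congr (_ - _ - (_ - _)).
  - rewrite (sum_unitary_row (fun i => d i * x i) Wu); exact: retr_hdiagM_diag.
  - exact: retr_hdiagM.
  - rewrite retrC; exact: retr_hdiagM.
  - rewrite (sum_unitary_col (fun i => e i * y i) Wu); exact: retr_hdiagM_diag.
rewrite -!sumrB; apply: eq_bigr => i _; rewrite -!sumrB.
by apply: eq_bigr => j _; ring.
Qed.

(** Between an eigenvector of the first matrix and one of the second, each matrix acts as its
    eigenvalue. *)
Lemma nsq_mixed_difference U V (x y : 'I_n -> R) i j :
  U \is unitarymx -> V \is unitarymx ->
  nsq ((U *m (hdiag U x - hdiag V y) *m V^t*) i j) =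
  nsq ((U *m V^t*) i j) * (x i - y j) ^+ 2.
Proof.
move=> Uu Vu; rewrite !hdiagE two_sidedB (two_sided_left V (rdiag x) Uu).
rewrite (two_sided_right U (rdiag y) Vu) mulrC -nsq_realM; congr nsq.
by rewrite !rdiagE mxE [X in _ + X]mxE mul_diag_mx mul_mx_diag !mxE rmorphB; ring.
Qed.

Lemma signed_pow_monotone p P Q : 1 < p <= 2 -> P^t* = P -> Q^t* = Q ->
  (p - 1) * trpow p (P - Q) `^ (2 / p) <=
  retr ((signed_pow (p - 1) P - signed_pow (p - 1) Q) *m (P - Q)) *
    ((trpow p P + trpow p Q) / 2) `^ ((2 - p) / p).
Proof.
move=> p12 Ph Qh; have /andP[p1 p2] := p12.
have Dh : (P - Q)^t* = P - Q.
  by rewrite -{2}Ph -{2}Qh; apply/matrixP => i j; rewrite !mxE rmorphB.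
have [G [d [Gu DE]]] := hermitian_hdiag Dh.
have [U [x [Uu PE]]] := hermitian_hdiag Ph.
have [V [y [Vu QE]]] := hermitian_hdiag Qh.
have Wu := unitary_mul_adj Uu Vu; set c := U *m V^t* in Wu.
have au := unitary_mul_adj Uu Gu; have bu := unitary_mul_adj Vu Gu.
set a := U *m G^t* in au; set b := V *m G^t* in bu.
have DW i j : nsq ((a *m rdiag d *m b^t*) i j) = nsq (c i j) * (x i - y j) ^+ 2.
  rewrite (two_sided_basis U V G (rdiag d)) -hdiagE -DE PE QE.
  exact: nsq_mixed_difference.
have -> : retr ((signed_pow (p - 1) P - signed_pow (p - 1) Q) *m (P - Q)) =
  \sum_i \sum_j nsq (c i j) *
    ((spowR (p - 1) (x i) - spowR (p - 1) (y j)) * (x i - y j)).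
  rewrite PE QE !signed_powE (herm_calc_hdiag _ x Uu) (herm_calc_hdiag _ y Vu).
  exact: retr_mixed_difference.
pose m i j := (`|x i| + `|y j|) / 2.
(* The mean of the k-th diagonal entries of |P| and |Q| in the eigenbasis [G] of P - Q. *)
pose l k := (\sum_i nsq (a i k) * `|x i| + \sum_j nsq (b j k) * `|y j|) / 2.
have m0 i j : 0 <= m i j by rewrite divr_ge0// addr_ge0.
have l0 k : 0 <= l k.
  by rewrite divr_ge0// addr_ge0// sumr_ge0// => i _; rewrite mulr_ge0 ?nsq_ge0.
set T := \sum_i \sum_j _.
have TD : (p - 1) * (\sum_i \sum_j nsq ((a *m rdiag d *m b^t*) i j) * m i j `^ (p - 2)) <= T.
  rewrite mulr_sumr; apply: ler_sum => i _; rewrite mulr_sumr; apply: ler_sum => j _.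
  have := ler_wpM2l (nsq_ge0 (c i j)) (spowR_monotone (x i) (y j) p12).
  by apply: le_trans; rewrite DW -/(m i j) le_eqVlt; apply/orP; left; apply/eqP; ring.
have res s : 0 < s -> \sum_k d k ^+ 2 / (l k + s) <=
    \sum_(ij : 'I_n * 'I_n) nsq ((a *m rdiag d *m b^t*) ij.1 ij.2) / (m ij.1 ij.2 + s).
  move=> s0; rewrite -(pair_bigA _ (fun i j =>
    nsq ((a *m rdiag d *m b^t*) i j) / (m i j + s)))/=.
  exact: (resolvent_compression d au bu (fun i => normr_ge0 (x i)) (fun i => normr_ge0 (y i)) s0).
have mc (ij : 'I_n * 'I_n) : m ij.1 ij.2 = 0 -> nsq ((a *m rdiag d *m b^t*) ij.1 ij.2) = 0.
  case: ij => i j /= mE; rewrite DW.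
  have := normr_ge0 (x i); have := normr_ge0 (y j) => yj xi.
  have /normr0_eq0 xE : `|x i| = 0 by move: mE; rewrite /m; lra.
  have /normr0_eq0 yE : `|y j| = 0 by move: mE; rewrite /m; lra.
  by rewrite xE yE subrr expr0n mulr0.
have d0 k : 0 <= d k ^+ 2 by exact: sqr_ge0.
(* Where [l] vanishes so does [d]; the default value of a negative power at 0 is therefore
   harmless. *)
have ld := resolvent_pole_eq0 (fun ij => nsq_ge0 _) (fun ij => m0 ij.1 ij.2) mc d0 l0 res.
have DL : \sum_k d k ^+ 2 * l k `^ (p - 2) <=
    \sum_i \sum_j nsq ((a *m rdiag d *m b^t*) i j) * m i j `^ (p - 2).
  have th : 0 <= 2 - p < 1 by lra.
  have := le_powRN_of_resolvent th (fun ij => nsq_ge0 _) (fun ij => m0 ij.1 ij.2) mc d0 l0 ld res.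
  rewrite -(pair_bigA _ (fun i j =>
    nsq ((a *m rdiag d *m b^t*) i j) * m i j `^ (- (2 - p))))/=.
  by rewrite opprB.
(* Squared moduli of unitary entries have unit row and column sums: Jensen applies in each column
   and summing over columns restores the full trace. *)
have LS : \sum_k l k `^ p <= (trpow p P + trpow p Q) / 2.
  have jens (e : 'M[R[i]]_n) (z : 'I_n -> R) : e \is unitarymx ->
      \sum_k (\sum_i nsq (e i k) * `|z i|) `^ p <= \sum_i `|z i| `^ p.
    move=> eu; rewrite -(sum_unitary_row (fun i => `|z i| `^ p) eu) exchange_big/=.
    apply: ler_sum => k _; apply: powR_jensen => //; first exact: ltW.
      by move=> i; exact: nsq_ge0.
    exact: unitary_col_sum.
  have := lerD (jens a x au) (jens b y bu).
  rewrite -(trpow_hdiag p x Uu) -(trpow_hdiag p y Vu) -PE -QE -big_split/=.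
  move=> H; apply: (@le_trans _ _ ((\sum_k ((\sum_i nsq (a i k) * `|x i|) `^ p +
    (\sum_i nsq (b i k) * `|y i|) `^ p)) / 2)); last by rewrite ler_pM2r ?invr_gt0.
  rewrite mulr_suml; apply: ler_sum => k _; apply: powR_midpoint; first exact: ltW.
    by apply: sumr_ge0 => i _; rewrite mulr_ge0 ?nsq_ge0.
  by apply: sumr_ge0 => i _; rewrite mulr_ge0 ?nsq_ge0.
have ld' k : l k = 0 -> d k = 0.
  by move=> /ld/eqP; rewrite sqrf_eq0 => /eqP.
have := reverse_holder p12 l0 ld' LS; rewrite DE (trpow_hdiag _ _ Gu).
have pm0 : 0 <= p - 1 by lra.
move=> /(ler_wpM2l pm0) /le_trans; apply.
rewrite mulrA ler_wpM2r ?powR_ge0//.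
by apply: le_trans TD; rewrite ler_wpM2l.
Qed.

End TracePower.

(** * Linearity of the adjoint and additive identities *)

Section Adjoint.
Variables (C : numClosedFieldType) (m n : nat).
Implicit Types X Y : 'M[C]_(m, n).

Lemma adjmxD X Y : (X + Y)^t* = X^t* + Y^t*.
Proof. by apply/matrixP => i j; rewrite !mxE rmorphD. Qed.

Lemma adjmxB X Y : (X - Y)^t* = X^t* - Y^t*.
Proof. by apply/matrixP => i j; rewrite !mxE rmorphB. Qed.

Lemma adjmxZ k X : (k *: X)^t* = Num.conj k *: X^t*.
Proof. by apply/matrixP => i j; rewrite !mxE rmorphM. Qed.

Lemma add_scaleD k l X Y : X + (k + l) *: Y = X + k *: Y + l *: Y.
Proof. by rewrite scalerDl addrA. Qed.

Lemma sub_scaleD k l X Y : X - (k + l) *: Y = X - k *: Y - l *: Y.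
Proof. by rewrite scalerDl opprD addrA. Qed.

Lemma add_sub_scale k X Y : X + k *: Y - (X - k *: Y) = (k + k) *: Y.
Proof. by rewrite scalerDl opprB addrC subrKA. Qed.

Lemma add_addB X Y : X + Y + (X - Y) = X + X.
Proof. by rewrite addrACA subrr addr0. Qed.

Lemma add_subB X Y : X + Y - (X - Y) = Y + Y.
Proof. by rewrite opprB addrC subrKA. Qed.

End Adjoint.

(** * The two inequalities for Hermitian matrices *)

Section HermitianTwoConvexity.
Variables (R : realType) (n : nat).
Implicit Types (A B X Y : 'M[R[i]]_n) (p t : R).

Lemma adjD X Y : X^t* = X -> Y^t* = Y -> (X + Y)^t* = X + Y.
Proof. by move=> Xh Yh; rewrite (adjmxD X Y) Xh Yh. Qed.

Lemma adj_realZ t X : X^t* = X -> (t%:C *: X)^t* = t%:C *: X.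
Proof. by move=> Xh; rewrite (adjmxZ t%:C X) Xh conj_real. Qed.

Lemma adjB X Y : X^t* = X -> Y^t* = Y -> (X - Y)^t* = X - Y.
Proof. by move=> Xh Yh; rewrite (adjmxB X Y) Xh Yh. Qed.

Lemma klein_add p X Y : 1 < p -> X^t* = X -> Y^t* = Y ->
  trpow p X + p * retr (signed_pow (p - 1) X *m Y) <= trpow p (X + Y).
Proof. by move=> p1 Xh Yh; have := klein p1 Xh (adjD Xh Yh); rewrite addrAC subrr add0r. Qed.

Lemma retr_mulN X Y : retr (X *m - Y) = - retr (X *m Y).
Proof. by rewrite mulmxN retrN. Qed.

Lemma klein_sub p X Y : 1 < p -> X^t* = X -> Y^t* = Y ->
  trpow p X - p * retr (signed_pow (p - 1) X *m Y) <= trpow p (X - Y).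
Proof.
move=> p1 Xh Yh; have := klein p1 Xh (adjB Xh Yh).
by rewrite addrAC subrr add0r retr_mulN mulrN.
Qed.

Lemma retr_mulBl X Y A : retr ((X - Y) *m A) = retr (X *m A) - retr (Y *m A).
Proof. by rewrite mulmxBl retrB. Qed.

Lemma retr_mulZ t X Y : retr (X *m (t%:C *: Y)) = t * retr (X *m Y).
Proof. by rewrite -scalemxAr retrZ. Qed.

Lemma trpow_increment p e P Q B : 1 < p -> P^t* = P -> Q^t* = Q -> B^t* = B ->
  (trpow p P + trpow p Q) / 2 +
    p * e * retr ((signed_pow (p - 1) P - signed_pow (p - 1) Q) *m B) / 2 <=
  (trpow p (P + e%:C *: B) + trpow p (Q - e%:C *: B)) / 2.
Proof.
move=> p1 Ph Qh Bh; rewrite retr_mulBl.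
have aux (a b a' b' u v : R) : a + p * (e * u) <= a' -> b - p * (e * v) <= b' ->
    (a + b) / 2 + p * e * (u - v) / 2 <= (a' + b') / 2 by lra.
apply: aux.
  by rewrite -retr_mulZ; apply: klein_add => //; exact: adj_realZ.
by rewrite -retr_mulZ; apply: klein_sub => //; exact: adj_realZ.
Qed.

(** Homogeneity: the monotonicity bound for P - Q = 2tB, divided by 2t. At t = 0 both sides
    vanish. *)
Lemma signed_pow_monotone_direction p t P Q B : 1 < p <= 2 -> 0 <= t ->
  P^t* = P -> Q^t* = Q -> B^t* = B -> P - Q = (2 * t)%:C *: B ->
  (p - 1) * (2 * t * trpow p B `^ (2 / p)) <=
  retr ((signed_pow (p - 1) P - signed_pow (p - 1) Q) *m B) *
    ((trpow p P + trpow p Q) / 2) `^ ((2 - p) / p).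
Proof.
move=> p12 t0 Ph Qh Bh PQ; have p0 : 0 < p by lra.
have [tE|tn] := eqVneq t 0.
  have -> : P = Q.
    by apply/eqP; rewrite -subr_eq0 PQ tE mulr0 rmorph0 scale0r.
  by rewrite retr_mulBl subrr tE mulr0 !mul0r mulr0.
have t2 : 0 < 2 * t by rewrite mulr_gt0// lt_neqAle eq_sym tn.
have := signed_pow_monotone p12 Ph Qh.
rewrite PQ retr_mulZ (trpow_scale _ _ Bh).
have aux (N u k : R) : 0 <= N ->
    (p - 1) * (`|2 * t| `^ p * N) `^ (2 / p) <= 2 * t * u * k ->
    (p - 1) * (2 * t * N `^ (2 / p)) <= u * k.
  move=> N0; rewrite (powRM _ (powR_ge0 _ _) N0) -powRrM (gtr0_norm t2).
  have -> : p * (2 / p) = 2%:R by field; rewrite gt_eqF.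
  rewrite (powR_mulrn _ (ltW t2)) => H; rewrite -(ler_pM2l t2).
  by move: H; congr (_ <= _); ring.
by apply: aux; exact: trpow_ge0.
Qed.

(** The tangent of the convex power 2/p at x carries the factor x^((2-p)/p), exactly the one in the
    monotonicity bound. *)
Lemma powR_step p t e x y s b : 1 < p <= 2 -> 0 <= e -> 0 <= x -> 0 <= y ->
  x + p * e * s / 2 <= y -> (p - 1) * (2 * t * b) <= s * x `^ ((2 - p) / p) ->
  x `^ (2 / p) + 2 * (p - 1) * e * t * b <= y `^ (2 / p).
Proof.
move=> p12 e0 x0 y0 xy sb; have p0 : 0 < p by lra.
have a1 : 1 <= 2 / p by rewrite ler_pdivlMr//; lra.
have := powR_tangent a1 x0 y0.
apply: le_trans; rewrite lerD2l.
have -> : 2 / p - 1 = (2 - p) / p by field; rewrite gt_eqF.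
set k := x `^ _ in sb *.
have k0 : 0 <= k by exact: powR_ge0.
apply: (@le_trans _ _ (2 / p * k * (p * e * s / 2))).
  have -> : 2 / p * k * (p * e * s / 2) = e * (s * k) by field; rewrite gt_eqF.
  by have := ler_wpM2l e0 sb; congr (_ <= _); ring.
have c0 : 0 <= 2 / p * k by rewrite mulr_ge0// divr_ge0// ltW.
by rewrite ler_wpM2l// lerBrDl.
Qed.

Definition mean_trpow p A B t : R :=
  (trpow p (A + t%:C *: B) + trpow p (A - t%:C *: B)) / 2.

Lemma mean_trpow_ge0 p A B t : A^t* = A -> B^t* = B -> 0 <= mean_trpow p A B t.
Proof.
move=> Ah Bh; have Bt := adj_realZ t Bh.
by rewrite divr_ge0//; apply: addr_ge0; apply: trpow_ge0; [exact: adjD|exact: adjB].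
Qed.

Lemma mean_trpow_step p A B t e : 1 < p <= 2 -> A^t* = A -> B^t* = B ->
  0 <= t -> 0 <= e ->
  mean_trpow p A B t `^ (2 / p) + 2 * (p - 1) * e * t * trpow p B `^ (2 / p) <=
  mean_trpow p A B (t + e) `^ (2 / p).
Proof.
move=> p12 Ah Bh t0 e0; have /andP[p1 p2] := p12.
have Bt := adj_realZ t Bh.
have Ph := adjD Ah Bt; have Qh := adjB Ah Bt.
have inc := trpow_increment e p1 Ph Qh Bh.
have PQ : A + t%:C *: B - (A - t%:C *: B) = (2 * t)%:C *: B.
  by rewrite add_sub_scale -rmorphD mulr_natl mulr2n.
have mono := signed_pow_monotone_direction p12 t0 Ph Qh Bh PQ.
apply: (powR_step p12 e0 _ _ _ mono); try exact: mean_trpow_ge0.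
by rewrite /mean_trpow rmorphD add_scaleD sub_scaleD.
Qed.

(* Summing the increments of [f] over a uniform subdivision of [0, 1]. *)
Lemma quadratic_growth (f : R -> R) K : 0 <= K ->
  (forall t e, 0 <= t -> 0 <= e -> f t + 2 * K * e * t <= f (t + e)) ->
  f 0 + K <= f 1.
Proof.
move=> K0 step.
(* The sum of 2 K (1/N) (j/N) over j < k; at k = N it is K - K/N. *)
have steps (N : R) k : 0 < N -> f 0 + K * (k%:R * (k%:R - 1) / N ^+ 2) <= f (k%:R / N).
  move=> N0; elim: k => [|k IH]; first by rewrite !mul0r mulr0 addr0.
  have e0 : 0 <= N^-1 by rewrite invr_ge0 ltW.
  have t0 : 0 <= k%:R / N by rewrite divr_ge0// ltW.
  have := step _ _ t0 e0.
  have -> : k%:R / N + N^-1 = k.+1%:R / N by rewrite -[k.+1%:R]natr1 mulrDl mul1r.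
  apply: le_trans; rewrite -lerBlDr; apply: le_trans IH.
  rewrite le_eqVlt; apply/orP; left; apply/eqP.
  by rewrite -[k.+1%:R]natr1; field; rewrite gt_eqF.
apply/ler_addgt0Pr => e e0; rewrite -lerBlDr.
have [N Ke] : exists N : nat, K / e <= N.+1%:R.
  exists (Num.truncn (K / e)); apply: ltW; exact: truncnS_gt.
have N0 : 0 < N.+1%:R :> R by rewrite ltr0n.
have := steps _ N.+1 N0; rewrite divff ?gt_eqF//; apply: le_trans.
rewrite -addrA lerD2l.
move: (N.+1%:R) N0 Ke => z z0 Ke.
have -> : K * (z * (z - 1) / z ^+ 2) = K - K / z by field; rewrite gt_eqF.
by rewrite lerD2l lerN2 ler_pdivrMr// mulrC -ler_pdivrMr.
Qed.

Lemma mean_trpow_uniform_convexity p A B : 1 < p <= 2 -> A^t* = A -> B^t* = B ->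
  trpow p A `^ (2 / p) + (p - 1) * trpow p B `^ (2 / p) <=
  ((trpow p (A + B) + trpow p (A - B)) / 2) `^ (2 / p).
Proof.
move=> p12 Ah Bh; have /andP[p1 p2] := p12.
have K0 : 0 <= (p - 1) * trpow p B `^ (2 / p) by rewrite mulr_ge0 ?powR_ge0//; lra.
have mean0 : mean_trpow p A B 0 = trpow p A.
  by rewrite /mean_trpow scale0r addr0 subr0; move: (trpow p A) => x; field.
have mean1 : mean_trpow p A B 1 = (trpow p (A + B) + trpow p (A - B)) / 2.
  by rewrite /mean_trpow scale1r.
rewrite -mean0 -mean1.
apply: (quadratic_growth (f := fun t => mean_trpow p A B t `^ (2 / p))) K0 _ => t e t0 e0.
apply: le_trans (mean_trpow_step p12 Ah Bh t0 e0).
rewrite le_eqVlt; apply/orP; left; apply/eqP; congr (_ + _).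
by move: (trpow p B `^ _) => k; ring.
Qed.

Lemma retr_polar A B X Y : retr ((A + B) *m X) + retr ((A - B) *m Y) =
  retr (A *m (X + Y)) + retr (B *m (X - Y)).
Proof.
rewrite retr_mulBl mulmxDl retrD [B *m (X - Y)]mulmxBr retrB mulmxDr retrD.
by move: (retr (A *m X)) (retr (A *m Y)) (retr (B *m X)) (retr (B *m Y)) => a b c d; ring.
Qed.

Definition hnorm p X : R := trpow p X `^ p^-1.

Lemma hnorm_ge0 p X : 0 <= hnorm p X.
Proof. exact: powR_ge0. Qed.

Lemma hnorm_sqr p X : hnorm p X ^+ 2 = trpow p X `^ (2 / p).
Proof. by rewrite -powR_mulrn ?hnorm_ge0// -powRrM mulrC. Qed.

Lemma hnormZ p t X : 0 < p -> 0 <= t -> X^t* = X -> hnorm p (t%:C *: X) = t * hnorm p X.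
Proof.
move=> p0 t0 Xh; rewrite /hnorm trpow_scale// powRM ?powR_ge0 ?trpow_ge0//.
by rewrite -powRrM mulfV ?gt_eqF// powRr1// ger0_norm.
Qed.

(** Convexity of the power 2/p passes from the mean of p-th powers of norms to the mean of their
    squares. *)
Lemma hermitian_uniform_convexity p A B : 1 < p <= 2 -> A^t* = A -> B^t* = B ->
  2 * hnorm p A ^+ 2 + 2 * (p - 1) * hnorm p B ^+ 2 <=
  hnorm p (A + B) ^+ 2 + hnorm p (A - B) ^+ 2.
Proof.
move=> p12 Ah Bh; have /andP[p1 p2] := p12; have p0 : 0 < p by lra.
have a1 : 1 <= 2 / p by rewrite ler_pdivlMr// mul1r.
have aux (a b c d e : R) : a + (p - 1) * b <= e -> e <= (c + d) / 2 ->
  2 * a + 2 * (p - 1) * b <= c + d by lra.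
rewrite (hnorm_sqr p A) (hnorm_sqr p B) (hnorm_sqr p (A + B)) (hnorm_sqr p (A - B)).
apply: aux (mean_trpow_uniform_convexity p12 Ah Bh) _.
exact: powR_midpoint a1 (trpow_ge0 p (adjD Ah Bh)) (trpow_ge0 p (adjB Ah Bh)).
Qed.

Lemma holder p X Y : 1 < p -> X^t* = X -> Y^t* = Y ->
  retr (X *m Y) <= hnorm p X * hnorm (p / (p - 1)) Y.
Proof.
move=> p1 /hermitian_hdiag[U [x [Uu ->]]] /hermitian_hdiag[V [y [Vu ->]]].
have Wu := unitary_mul_adj Uu Vu.
rewrite retr_hdiagM /hnorm (trpow_hdiag p x Uu) (trpow_hdiag _ y Vu).
apply: bistochastic_holder => // [i j|i|j]; first exact: nsq_ge0.
  exact: unitary_row_sum.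
exact: unitary_col_sum.
Qed.

Lemma norming_hermitian p X : 1 < p -> X^t* = X ->
  exists Y, [/\ Y^t* = Y, retr (X *m Y) = hnorm p X ^+ 2
    & hnorm (p / (p - 1)) Y = hnorm p X].
Proof.
move=> p1 Xh; have p0 : 0 < p by lra.
have pm0 : 0 < p - 1 by lra.
set q := p / (p - 1); have q0 : 0 < q by rewrite divr_gt0.
set a := hnorm p X; have a0 : 0 <= a by exact: hnorm_ge0.
have hX := signed_pow_hermitian (p - 1) Xh.
(* With h(X) the signed power, Tr X h(X) and the q-th power of the q-norm of h(X) both equal a^p.
   The scalar a^(2-p) makes the pairing a^2 and the dual norm a. *)
exists ((a `^ (2 - p))%:C *: signed_pow (p - 1) X).
have XhX : retr (X *m signed_pow (p - 1) X) = trpow p X.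
  have [U [x [Uu ->]]] := hermitian_hdiag Xh.
  rewrite signed_powE (herm_calc_hdiag _ x Uu) (retr_hdiagM_diag _ _ Uu) (trpow_hdiag p x Uu).
  by apply: eq_bigr => i _; rewrite mulrC; exact: spowR_mulr.
have NhX : trpow q (signed_pow (p - 1) X) = trpow p X.
  have [U [x [Uu ->]]] := hermitian_hdiag Xh.
  rewrite signed_powE (herm_calc_hdiag _ x Uu) (trpow_hdiag q _ Uu) (trpow_hdiag p x Uu).
  apply: eq_bigr => i _ /=; rewrite normr_spowR ?gt_eqF// -powRrM; congr powR.
  by rewrite /q; field; rewrite gt_eqF.
have N0 := trpow_ge0 p Xh.
have NE : trpow p X = a `^ p by rewrite /a /hnorm -powRrM mulVf ?gt_eqF// powRr1.
split; first exact: adj_realZ.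
  rewrite retr_mulZ XhX NE -powRD.
    by rewrite subrK powR_mulrn.
  by rewrite subrK pnatr_eq0.
rewrite hnormZ ?powR_ge0// /hnorm NhX NE -powRrM -powRD.
  rewrite -[RHS](powRr1 a0); congr powR.
  by rewrite /q; field; rewrite !gt_eqF.
have -> : 2 - p + p * q^-1 = 1 by rewrite /q; field; rewrite !gt_eqF.
by rewrite oner_eq0.
Qed.

(** Duality: norming matrices [X], [Y] of A + B and A - B turn the left side into Tr A(X+Y) + Tr
    B(X-Y). Hoelder and the convexity inequality at the conjugate exponent q, where q - 1 = 1/(p-1),
    bound it. *)
Lemma hermitian_uniform_smoothness p A B : 2 <= p -> A^t* = A -> B^t* = B ->
  hnorm p (A + B) ^+ 2 + hnorm p (A - B) ^+ 2 <=
  2 * hnorm p A ^+ 2 + 2 * (p - 1) * hnorm p B ^+ 2.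
Proof.
move=> p2 Ah Bh; have p1 : 1 < p by lra.
have pm0 : 0 < p - 1 by lra.
set q := p / (p - 1).
have q12 : 1 < q <= 2 by rewrite /q ltr_pdivlMr// ler_pdivrMr//; lra.
have q0 : 0 < q by rewrite (lt_trans ltr01)//; case/andP: q12.
have [X [Xh AX NX]] := norming_hermitian p1 (adjD Ah Bh).
have [Y [Yh AY NY]] := norming_hermitian p1 (adjB Ah Bh).
have XYp := adjD Xh Yh; have XYm := adjB Xh Yh.
have two (Z : 'M[R[i]]_n) : Z^t* = Z -> hnorm q (Z + Z) = 2 * hnorm q Z.
  move=> Zh; rewrite -(hnormZ q0 (ler0n R 2) Zh).
  by rewrite rmorph_nat scaler_nat mulr2n.
have HA := holder p1 Ah XYp; have HB := holder p1 Bh XYm.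
have C2 := hermitian_uniform_convexity q12 XYp XYm.
rewrite add_addB add_subB (two X Xh) (two Y Yh) NX NY in C2.
have E : hnorm p (A + B) ^+ 2 + hnorm p (A - B) ^+ 2 =
  retr (A *m (X + Y)) + retr (B *m (X - Y)).
  by rewrite -AX -AY retr_polar.
rewrite E; apply: (le_trans (lerD HA HB)).
have E2 : hnorm p (A + B) ^+ 2 + hnorm p (A - B) ^+ 2 <=
    hnorm p A * hnorm q (X + Y) + hnorm p B * hnorm q (X - Y).
  by rewrite E; exact: lerD.
have q1 : q - 1 = (p - 1)^-1 by rewrite /q; field; rewrite gt_eqF.
rewrite q1 in C2.
have aux (a b u v x y : R) : x ^+ 2 + y ^+ 2 <= a * u + b * v ->
    2 * u ^+ 2 + 2 * (p - 1)^-1 * v ^+ 2 <= (2 * x) ^+ 2 + (2 * y) ^+ 2 ->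
    a * u + b * v <= 2 * a ^+ 2 + 2 * (p - 1) * b ^+ 2.
  move: (p - 1) pm0 => k k0; have : 0 < k^-1 by rewrite invr_gt0.
  have : k * k^-1 = 1 by rewrite divff ?gt_eqF.
  move: k^-1 => r kr r0 H1 H2.
  (* These squares bound a u and b v by quadratic terms; the u and v parts are absorbed through the
     convexity inequality. *)
  have S1 := sqr_ge0 (2 * a - u).
  have S2 : 0 <= r * (2 * k * b - v) ^+ 2 by exact: mulr_ge0 (ltW r0) (sqr_ge0 _).
  have S3 : r * (2 * k * b - v) ^+ 2 = 4 * k * b ^+ 2 - 4 * b * v + r * v ^+ 2.
    transitivity (4 * (k * r) * k * b ^+ 2 - 4 * (k * r) * b * v + r * v ^+ 2); first by ring.
    by rewrite kr; ring.
  by rewrite S3 in S2; lra.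
exact: aux E2 C2.
Qed.

End HermitianTwoConvexity.

(** * Hermitian dilation of a rectangular matrix *)

Section BlockDiagonal.
Variables (C : numClosedFieldType) (m n : nat).
Implicit Types (X : 'M[C]_(m, n)) (U D : 'M[C]_m) (V E : 'M[C]_n).

Definition hdil X : 'M[C]_(m + n) := block_mx 0 X (X^t*) 0.

Lemma adj_block_mx U X Y V :
  (block_mx U X Y V)^t* = block_mx (U^t*) (Y^t*) (X^t*) (V^t*).
Proof. by rewrite tr_block_mx map_block_mx. Qed.

Lemma adj_hdil X : (hdil X)^t* = hdil X.
Proof. by rewrite /hdil adj_block_mx adjmxK !trmx0 !map_mx0. Qed.

Lemma hdilD X Y : hdil (X + Y) = hdil X + hdil Y.
Proof. by rewrite /hdil add_block_mx adjmxD !addr0. Qed.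

Lemma hdilB X Y : hdil (X - Y) = hdil X - hdil Y.
Proof. by rewrite /hdil opp_block_mx add_block_mx adjmxB !oppr0 !addr0. Qed.

Lemma hdil_sqr X : hdil X *m hdil X = block_mx (X *m X^t*) 0 0 (X^t* *m X).
Proof. by rewrite /hdil mulmx_block !mul0mx !mulmx0 !addr0 !add0r. Qed.

Lemma unitary_block U V : U \is unitarymx -> V \is unitarymx ->
  block_mx U 0 0 V \is unitarymx.
Proof.
move=> /unitarymxP Uu /unitarymxP Vu; apply/unitarymxP.
rewrite adj_block_mx mulmx_block !trmx0 !map_mx0 !mul0mx !mulmx0 Uu Vu.
by rewrite !addr0 add0r -scalar_mx_block.
Qed.

Lemma block_conj_diag U D V E :
  (block_mx U 0 0 V)^t* *m block_mx D 0 0 E *m block_mx U 0 0 V =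
  block_mx (U^t* *m D *m U) 0 0 (V^t* *m E *m V).
Proof.
by rewrite adj_block_mx !mulmx_block !trmx0 !map_mx0 !(mul0mx, mulmx0, addr0, add0r).
Qed.

Lemma gram_svd_row U X V D : U \is unitarymx -> V \is unitarymx ->
  X *m X^t* = U^t* *m D *m U -> (U *m X *m V^t*) *m (U *m X *m V^t*)^t* = D.
Proof.
move=> Uu Vu XE; rewrite (gram_two_sided U X Vu) XE (two_sided_right _ _ Uu).
by have /unitarymxP -> := Uu; rewrite mul1mx.
Qed.

End BlockDiagonal.

(** * Gram spectra and the Schatten norm of the dilation *)

Section GramSpectrum.
Variables (R : realType) (m n : nat).
Implicit Types (X : 'M[R[i]]_(m, n)).

Lemma schatten_gram a b p (X : 'M[R[i]]_(a, b)) (V : 'M[R[i]]_b)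
    (k : 'I_b -> R) : V \is unitarymx ->
  X^t* *m X = hdiag V k ->
  schatten p X = (\sum_j Num.sqrt (k j) `^ p) `^ p^-1.
Proof.
move=> Vu XE; rewrite /schatten /absmx XE (herm_calc_hdiag _ k Vu).
by rewrite (herm_calc_hdiag _ _ Vu) (tr_hdiag _ Vu).
Qed.

Lemma diag_row_nsq a b (G : 'M[R[i]]_(a, b)) (l : 'I_a -> R) i :
  G *m G^t* = rdiag l -> \sum_j nsq (G i j) = l i.
Proof.
move=> /matrixP/(_ i i); rewrite rdiagE !mxE eqxx mulr1n => H.
apply: complexI; rewrite -H rmorph_sum; apply: eq_bigr => j _.
by rewrite !mxE nsqE.
Qed.

(* In singular bases [G = U X V^*] intertwines the two Gram spectra: its entry
   [G i j] vanishes unless [l i = k j]. *)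
Lemma sum_gram_spectrum X (U : 'M[R[i]]_m) (V : 'M[R[i]]_n) l k (f : R -> R) :
  f 0 = 0 -> U \is unitarymx -> V \is unitarymx ->
  X *m X^t* = hdiag U l -> X^t* *m X = hdiag V k ->
  \sum_i f (l i) = \sum_j f (k j).
Proof.
move=> f0 Uu Vu; rewrite !hdiagE => XXE XE.
set G := U *m X *m V^t*.
have GG : G *m G^t* = rdiag l by exact: gram_svd_row.
have GE : G^t* = V *m X^t* *m U^t* by rewrite /G !adjmxM adjmxK mulmxA.
have GG' : G^t* *m G = rdiag k.
  rewrite -{2}(adjmxK G) GE; apply: gram_svd_row => //; by rewrite adjmxK.
clear GE; clearbody G.
have lG i : \sum_j nsq (G i j) = l i by exact: diag_row_nsq.
have kG j : \sum_i nsq (G i j) = k j.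
  have H : G^t* *m (G^t*)^t* = rdiag k by rewrite adjmxK.
  rewrite -(diag_row_nsq j H); apply: eq_bigr => i _.
  by rewrite !mxE nsq_conj.
have inter : rdiag l *m G = G *m rdiag k.
  by rewrite -GG -GG'; exact/esym/mulmxA.
have lk i j : nsq (G i j) * (f (l i) / l i) = nsq (G i j) * (f (k j) / k j).
  move/matrixP/(_ i j): inter; rewrite !rdiagE mul_diag_mx mul_mx_diag !mxE mulrC.
  have [->|G0] := eqVneq (G i j) 0; first by rewrite /nsq /= expr0n addr0 !mul0r.
  by move=> /(mulfI G0)/complexI ->.
(* At r = 0 the quotient is 0 by convention, and f 0 = 0 keeps the identity. *)
have div r : r * (f r / r) = f r.
  have [->|r0] := eqVneq r 0; first by rewrite mul0r f0.
  by field.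
transitivity (\sum_i \sum_j nsq (G i j) * (f (l i) / l i)).
  by apply: eq_bigr => i _; rewrite -mulr_suml lG div.
transitivity (\sum_i \sum_j nsq (G i j) * (f (k j) / k j)).
  by apply: eq_bigr => i _; apply: eq_bigr => j _.
by rewrite exchange_big; apply: eq_bigr => j _; rewrite -mulr_suml kG div.
Qed.

Definition sum_fun (l : 'I_m -> R) (k : 'I_n -> R) (i : 'I_(m + n)) : R :=
  match fintype.split i with inl a => l a | inr b => k b end.

Lemma sum_funl l k a : sum_fun l k (lshift n a) = l a.
Proof. by rewrite /sum_fun (unsplitK (inl a)). Qed.

Lemma sum_funr l k b : sum_fun l k (rshift m b) = k b.
Proof. by rewrite /sum_fun (unsplitK (inr b)). Qed.

Lemma rdiag_sum_fun l k : rdiag (sum_fun l k) = block_mx (rdiag l) 0 0 (rdiag k).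
Proof.
rewrite !rdiagE -diag_mx_row; congr diag_mx; apply/rowP => i.
by case: (split_ordP i) => j ->; rewrite ?row_mxEl ?row_mxEr !mxE ?sum_funl ?sum_funr.
Qed.

(** The square of the dilation is block diagonal with the two Gram matrices of [X]. Their spectra
    differ at most by zeros, so the sum of p-th powers doubles. *)
Lemma schatten_hdil p X : 0 < p -> schatten p (hdil X) = 2 `^ p^-1 * schatten p X.
Proof.
move=> p0.
have Xh : (X^t* *m X)^t* = X^t* *m X by rewrite adjmxM adjmxK.
have XXh : (X *m X^t*)^t* = X *m X^t* by rewrite adjmxM adjmxK.
have [V [k [Vu XE]]] := hermitian_hdiag Xh.
have [U [l [Uu XXE]]] := hermitian_hdiag XXh.
have Bu := unitary_block Uu Vu.
have E : (hdil X)^t* *m hdil X = hdiag (block_mx U 0 0 V) (sum_fun l k).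
  rewrite adj_hdil hdil_sqr XXE XE !hdiagE rdiag_sum_fun.
  by rewrite (block_conj_diag U (rdiag l) V (rdiag k)).
rewrite (schatten_gram p Bu E) (schatten_gram p Vu XE) big_split_ord/=.
under eq_bigr do rewrite sum_funl.
under [X in _ + X]eq_bigr do rewrite sum_funr.
have f0 : Num.sqrt 0 `^ p = 0 :> R by rewrite sqrtr0 powR0 ?gt_eqF.
rewrite (sum_gram_spectrum (f := fun x => Num.sqrt x `^ p) f0 Uu Vu XXE XE).
set S := \sum_j _; have S0 : 0 <= S by apply: sumr_ge0 => j _; exact: powR_ge0.
by rewrite -(powRM _ _ S0)//; congr powR; ring.
Qed.

End GramSpectrum.

Theorem theorem1p1 (R : realType) (m n : nat) (A B : 'M[R[i]]_(m, n)) (p : R) :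
  (1 < p <= 2 ->
     schatten p (A + B) ^+ 2 + schatten p (A - B) ^+ 2
       >= 2 * schatten p A ^+ 2 + 2 * (p - 1) * schatten p B ^+ 2)
  /\
  (2 <= p ->
     schatten p (A + B) ^+ 2 + schatten p (A - B) ^+ 2
       <= 2 * schatten p A ^+ 2 + 2 * (p - 1) * schatten p B ^+ 2).
Proof.
have norm (X : 'M[R[i]]_(m, n)) : 0 < p -> hnorm p (hdil X) = 2 `^ p^-1 * schatten p X.
  by move=> p0; rewrite -(schatten_hdil X p0) (schatten_hermitian p (adj_hdil X)).
(* Dilation scales all four norms alike, so this common positive factor cancels from the Hermitian
   inequalities. *)
have c0 : 0 < (2 `^ p^-1) ^+ 2 :> R by rewrite exprn_gt0// powR_gt0.
have [CD CB] := (hdilD A B, hdilB A B).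
split=> [p12|p2].
  have p0 : 0 < p by lra.
  have := hermitian_uniform_convexity p12 (adj_hdil A) (adj_hdil B).
  rewrite -CD -CB (norm A p0) (norm B p0) (norm (A + B) p0) (norm (A - B) p0).
  move: (schatten p A) (schatten p B) (schatten p (A + B)) (schatten p (A - B)).
  move=> a b c d H; rewrite -(ler_pM2l c0).
  by move: H; congr (_ <= _); ring.
have p0 : 0 < p by lra.
have := hermitian_uniform_smoothness p2 (adj_hdil A) (adj_hdil B).
rewrite -CD -CB (norm A p0) (norm B p0) (norm (A + B) p0) (norm (A - B) p0).
move: (schatten p A) (schatten p B) (schatten p (A + B)) (schatten p (A - B)).
move=> a b c d H; rewrite -(ler_pM2l c0).
by move: H; congr (_ <= _); ring.
Qed.
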